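(* Let $(G,J)$ be a simply-connected, $2$-step nilpotent Lie group equipped with a left-invariant complex structure $J$, and assume that its Lie algebra $(\mathfrak g,\mu)$ is such that $J\mu(\mathfrak g,\mathfrak g)$ is contained in the center of $\mathfrak g$. Then a left-invariant Hermitian metric $g$ on $(G,J)$ is balanced if and only if the trace $\mathrm{Tr}_g K(g)$ coincides with the Riemannian scalar curvature of $g$. Moreover, if $g$ is balanced, then $K(g)$ coincides with the $(1,1)$-component of the Riemannian Ricci tensor of $g$.
   Context: A Hermitian metric is balanced if its fundamental form $\omega$ satisfies $d^*\omega=0$ (equivalently $d\omega^{n-1}=0$). For a Hermitian metric $g$, let $\nabla$ be its Chern connection, $\Omega$ its curvature, $T$ its torsion with components $T^l_{js}$ and $T_{js\bar p}=g_{l\bar p}T^l_{js}$, and $S(g)_{j\bar k}=g^{\bar rs}\Omega_{s\bar rj\bar k}$ the second Chern-Ricci curvature. Define $Q^1_{j\bar k}=g^{\bar pq}g^{\bar rs}T_{js\bar p}T_{\overline{kr}q}$, $Q^2_{j\bar k}=g^{\bar pq}g^{\bar rs}T_{sq\bar k}T_{\overline{rp}j}$, $Q^3_{j\bar k}=g^{\bar pq}g^{\bar rs}T_{js\bar r}T_{\overline{kp}q}$, $Q^4_{j\bar k}=\frac12g^{\bar pq}g^{\bar rs}\big(T_{qs\bar r}T_{\overline{pk}j}+T_{qj\bar k}T_{\overline{pr}s}\big)$, $Q=\frac12Q^1-\frac14Q^2-\frac12Q^3+Q^4$, and $K(g)=S(g)-Q(g)$ (the tensor of the Hermitian curvature flow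 of Streets-Tian). *)

(* Defs.v *)
(* Left-invariant Hermitian geometry of a (real) Lie algebra
   g = R^(2n), written in coordinates w.r.t. the standard basis e_0..e_(2n-1).
   Vectors are row vectors; linear maps act on the right (x |-> x *m A). *)
From HB Require Import structures.
From mathcomp Require Import all_boot all_order all_algebra.
From mathcomp Require Import complex.
Set Implicit Arguments. Unset Strict Implicit. Unset Printing Implicit Defensive.
Import Order.TTheory GRing.Theory Num.Theory.
Local Open Scope ring_scope.

Section Generic.
Variables (F : fieldType) (m : nat).

Definition bilin (c : 'I_m -> 'I_m -> 'rV[F]_m) (x y : 'rV[F]_m) : 'rV[F]_m :=
  \sum_(i < m) \sum_(j < m) (x 0 i * y 0 j) *: c i j.

Definition bform (B : 'M[F]_m) (x y : 'rV[F]_m) : F :=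
  \sum_(i < m) \sum_(j < m) x 0 i * B i j * y 0 j.

Definition ev (i : 'I_m) : 'rV[F]_m := delta_mx 0 i.


(* torsion of the left-invariant connection D (D_x y = bilin D x y),
   for the Lie bracket [x,y] = bilin br x y *)
Definition torsion (D br : 'I_m -> 'I_m -> 'rV[F]_m) (x y : 'rV[F]_m) :=
  bilin D x y - bilin D y x - bilin br x y.

Definition curv (D br : 'I_m -> 'I_m -> 'rV[F]_m) (x y z : 'rV[F]_m) :=
  bilin D x (bilin D y z) - bilin D y (bilin D x z) - bilin D (bilin br x y) z.
End Generic.
Arguments ev {F m} i.

Section Real.
Variables (R : rcfType) (m : nat).
Local Notation vec := 'rV[R]_m.
Implicit Types (br D L : 'I_m -> 'I_m -> vec) (Jm Gm : 'M[R]_m).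

Definition lie_algebra br : Prop :=
  (forall x : vec, bilin br x x = 0) /\
  (forall x y z : vec, bilin br x (bilin br y z) + bilin br y (bilin br z x)
                       + bilin br z (bilin br x y) = 0).

Definition two_step_nilpotent br : Prop :=
  lie_algebra br /\
  (forall x y z : vec, bilin br (bilin br x y) z = 0) /\
  (exists x y : vec, bilin br x y != 0).

Definition complex_structure br Jm : Prop :=
  Jm *m Jm = - 1%:M /\
  (forall x y : vec,
     bilin br (x *m Jm) (y *m Jm) - (bilin br (x *m Jm) y) *m Jm
     - (bilin br x (y *m Jm)) *m Jm - bilin br x y = 0).

Definition J_mu_central br Jm : Prop :=
  forall x y z : vec, bilin br ((bilin br x y) *m Jm) z = 0.

Definition hermitian_metric Jm Gm : Prop :=
  Gm^T = Gm /\ (forall x : vec, x != 0 -> 0 < bform Gm x x) /\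
  (forall x y : vec, bform Gm (x *m Jm) (y *m Jm) = bform Gm x y).

Definition levi_civita br Gm L : Prop :=
  (forall x y : vec, torsion L br x y = 0) /\
  (forall x y z : vec, bform Gm (bilin L x y) z + bform Gm y (bilin L x z) = 0).

(* D is the Chern connection: Dg = 0, DJ = 0, and the torsion has no
   (1,1)-part, i.e. T(Jx,Jy) = -T(x,y) *)
Definition chern_connection br Jm Gm D : Prop :=
  (forall x y z : vec, bform Gm (bilin D x y) z + bform Gm y (bilin D x z) = 0) /\
  (forall x y : vec, bilin D x (y *m Jm) = (bilin D x y) *m Jm) /\
  (forall x y : vec, torsion D br (x *m Jm) (y *m Jm) = - torsion D br x y).

Definition ricci br L (x y : vec) : R :=
  \sum_(i < m) (curv L br (ev i) x y) 0 i.

Definition scal br Gm L : R :=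
  \sum_(i < m) \sum_(j < m) (invmx Gm) i j * ricci br L (ev i) (ev j).

Definition ricci11 br Jm L (x y : vec) : R :=
  (ricci br L x y + ricci br L (x *m Jm) (y *m Jm)) / 2%:R.

(* fundamental form omega(x,y) = g(Jx,y) and its codifferential
   (d^* omega)(x) = - sum_i (nabla_{e_i} omega)(e_i, x)  (g-trace) *)
Definition fform Jm Gm (x y : vec) : R := bform Gm (x *m Jm) y.

Definition codiff_fform Jm Gm L (x : vec) : R :=
  - \sum_(i < m) \sum_(j < m) (invmx Gm) i j *
      (- fform Jm Gm (bilin L (ev i) (ev j)) x
       - fform Jm Gm (ev j) (bilin L (ev i) x)).

Definition balanced Jm Gm L : Prop := forall x : vec, codiff_fform Jm Gm L x = 0.
End Real.

Section Complex.
Local Open Scope complex_scope.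
Variables (R : rcfType) (n : nat).
Local Notation m := n.*2.
Local Notation C := (R[i]).
Local Notation vec := 'rV[R]_m.
Local Notation cvec := 'rV[C]_m.
Implicit Types (br D L : 'I_m -> 'I_m -> vec) (Jm Gm : 'M[R]_m)
               (Z : 'I_n -> cvec).

Definition cmx (p q : nat) (A : 'M[R]_(p, q)) : 'M[C]_(p, q) :=
  map_mx (fun r : R => r%:C) A.
Definition cconst (c : 'I_m -> 'I_m -> vec) : 'I_m -> 'I_m -> cvec :=
  fun i j => cmx (c i j).
Definition conjv (x : cvec) : cvec := map_mx (@conjc R) x.

Definition hol_frame Jm Z : Prop :=
  (forall j, Z j *m cmx Jm = 'i *: Z j) /\
  row_free (\matrix_(j < n, k < m) Z j 0 k).

Section Comp.
Variables (br : 'I_m -> 'I_m -> vec) (Gm : 'M[R]_m) (D : 'I_m -> 'I_m -> vec)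
          (Z : 'I_n -> cvec).

Definition gC (x y : cvec) : C := bform (cmx Gm) x y.
(* g_{j \bar k} and its inverse g^{\bar k j} = ginv k j *)
Definition gmat : 'M[C]_n := \matrix_(j, k) gC (Z j) (conjv (Z k)).
Definition ginv : 'M[C]_n := invmx gmat.

Definition Omega (s r j k : 'I_n) : C :=
  gC (curv (cconst D) (cconst br) (Z s) (conjv (Z r)) (Z j)) (conjv (Z k)).

Definition S2 (j k : 'I_n) : C :=
  \sum_(r < n) \sum_(s < n) ginv r s * Omega s r j k.

Definition Tt (j s p : 'I_n) : C :=
  gC (torsion (cconst D) (cconst br) (Z j) (Z s)) (conjv (Z p)).
Definition Tb (j s p : 'I_n) : C := (Tt j s p)^*.

Definition Q1 (j k : 'I_n) : C :=
  \sum_(p < n) \sum_(q < n) \sum_(r < n) \sum_(s < n)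
     ginv p q * ginv r s * Tt j s p * Tb k r q.
Definition Q2 (j k : 'I_n) : C :=
  \sum_(p < n) \sum_(q < n) \sum_(r < n) \sum_(s < n)
     ginv p q * ginv r s * Tt s q k * Tb r p j.
Definition Q3 (j k : 'I_n) : C :=
  \sum_(p < n) \sum_(q < n) \sum_(r < n) \sum_(s < n)
     ginv p q * ginv r s * Tt j s r * Tb k p q.
Definition Q4 (j k : 'I_n) : C :=
  2%:R^-1 * \sum_(p < n) \sum_(q < n) \sum_(r < n) \sum_(s < n)
     ginv p q * ginv r s * (Tt q s r * Tb p k j + Tt q j k * Tb p r s).
Definition Qt (j k : 'I_n) : C :=
  2%:R^-1 * Q1 j k - 4%:R^-1 * Q2 j k - 2%:R^-1 * Q3 j k + Q4 j k.

Definition Kt (j k : 'I_n) : C := S2 j k - Qt j k.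

(* Tr_g K: the Riemannian g-trace of the real J-invariant symmetric tensor
   whose complex components are K_{j \bar k}; it equals 2 g^{\bar k j} K_{j \bar k} *)
Definition trK : C := 2%:R * \sum_(j < n) \sum_(k < n) ginv k j * Kt j k.
End Comp.

Definition ricci11C br Jm L (x y : cvec) : C :=
  \sum_(i < m) \sum_(j < m) x 0 i * y 0 j * (ricci11 br Jm L (ev i) (ev j))%:C.
End Complex.

(* Main.v *)
Require Import Defs.
From HB Require Import structures.
From mathcomp Require Import all_boot all_order all_algebra.
From mathcomp Require Import complex ring lra.
Import Order.TTheory GRing.Theory Num.Theory.
Local Open Scope ring_scope.
Local Open Scope complex_scope.
Set Implicit Arguments.
Unset Strict Implicit.
Unset Printing Implicit Defensive.

(** Let [H = sum_s [Z_s, Zd_s]], where [Zd] is the frame of type (0,1) dual to [Z].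
    Since ad is nilpotent it is trace free, so the Chern torsion trace is [g (., H)]
    and [d^* omega] is, up to the factor [i], [g (H, .)]: balanced means [H = 0].
    Writing the Chern connection through the bracket and using that
    [[g, g] + J [g, g]] is central, [S], [Q^1] and [Q^2] become sums of a few
    quadratic expressions in the bracket, and [S - Q^1 / 2 + Q^2 / 4] is the
    Riemannian Ricci tensor
      [Ric (x, y) = - 1/2 sum g ([x, e_i], [y, e_i])
                    + 1/4 sum g ([e_i, e_j], x) g ([e_i, e_j], y)]
    evaluated on types (1,0) and (0,1). Hence [K = Ric^(1,1) + Q^3 / 2 - Q^4] for
    every metric; the last two terms vanish when [H = 0], and their trace is a
    negative multiple of the squared norm of the real vector [i H]. *)

(** * Bilinear maps and dual bases *)

Section Bilinear.
Variables (F : fieldType) (m : nat).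
Implicit Types (c : 'I_m -> 'I_m -> 'rV[F]_m) (B : 'M[F]_m) (x y z : 'rV[F]_m).

(** Linearity is stated on [k *: x + y] throughout: the section [LinearRules] derives additivity,
    scaling and sums from this one rule, and it is also the shape of the induction step in
    [cvec_ind]. *)
Lemma bilinPl c k x y z :
  bilin c (k *: x + y) z = k *: bilin c x z + bilin c y z.
Proof.
rewrite /bilin scaler_sumr -big_split; apply: eq_bigr => i _.
rewrite scaler_sumr -big_split; apply: eq_bigr => j _ /=.
by rewrite !mxE scalerA -scalerDl; congr (_ *: _); ring.
Qed.

Lemma bilinPr c k x y z :
  bilin c z (k *: x + y) = k *: bilin c z x + bilin c z y.
Proof.
rewrite /bilin scaler_sumr -big_split; apply: eq_bigr => i _.
rewrite scaler_sumr -big_split; apply: eq_bigr => j _ /=.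
by rewrite !mxE scalerA -scalerDl; congr (_ *: _); ring.
Qed.

Lemma bformPl B k x y z :
  bform B (k *: x + y) z = k * bform B x z + bform B y z.
Proof.
rewrite /bform mulr_sumr -big_split; apply: eq_bigr => i _.
rewrite mulr_sumr -big_split; apply: eq_bigr => j _ /=.
by rewrite !mxE; ring.
Qed.

Lemma bformPr B k x y z :
  bform B z (k *: x + y) = k * bform B z x + bform B z y.
Proof.
rewrite /bform mulr_sumr -big_split; apply: eq_bigr => i _.
rewrite mulr_sumr -big_split; apply: eq_bigr => j _ /=.
by rewrite !mxE; ring.
Qed.

Section LinearRules.
Variables (W : lmodType F) (f : 'rV[F]_m -> W).
Hypothesis fP : forall k x y, f (k *: x + y) = k *: f x + f y.

Lemma lin0 : f 0 = 0.
Proof.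
by have := fP 1 0 0; rewrite !scale1r addr0 => /eqP; rewrite -subr_eq subrr => /eqP.
Qed.

Lemma linD x y : f (x + y) = f x + f y.
Proof. by have := fP 1 x y; rewrite !scale1r. Qed.

Lemma linZ k x : f (k *: x) = k *: f x.
Proof. by have := fP k x 0; rewrite lin0 !addr0. Qed.

Lemma linN x : f (- x) = - f x.
Proof. by rewrite -[- x]scaleN1r linZ scaleN1r. Qed.

Lemma lin_sum I (r : seq I) (P : pred I) (E : I -> 'rV[F]_m) :
  f (\sum_(i <- r | P i) E i) = \sum_(i <- r | P i) f (E i).
Proof. by rewrite (big_morph f linD lin0). Qed.

Lemma lin_ev x : f x = \sum_i x 0 i *: f (ev i).
Proof.
by rewrite {1}(row_sum_delta x) lin_sum; apply: eq_bigr => i _; rewrite linZ.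
Qed.
End LinearRules.

Lemma bilinDl c x y z : bilin c (x + y) z = bilin c x z + bilin c y z.
Proof. exact: (linD (f := bilin c ^~ z) (fun k u v => bilinPl c k u v z)). Qed.
Lemma bilinDr c x y z : bilin c z (x + y) = bilin c z x + bilin c z y.
Proof. exact: (linD (fun k u v => bilinPr c k u v z)). Qed.
Lemma bilinZl c k x z : bilin c (k *: x) z = k *: bilin c x z.
Proof. exact: (linZ (f := bilin c ^~ z) (fun k u v => bilinPl c k u v z)). Qed.
Lemma bilinZr c k x z : bilin c z (k *: x) = k *: bilin c z x.
Proof. exact: (linZ (fun k u v => bilinPr c k u v z)). Qed.
Lemma bilinNl c x z : bilin c (- x) z = - bilin c x z.
Proof. exact: (linN (f := bilin c ^~ z) (fun k u v => bilinPl c k u v z)). Qed.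
Lemma bformDl B x y z : bform B (x + y) z = bform B x z + bform B y z.
Proof. exact: (linD (W := F^o) (f := bform B ^~ z) (fun k u v => bformPl B k u v z)). Qed.
Lemma bformDr B x y z : bform B z (x + y) = bform B z x + bform B z y.
Proof. exact: (linD (W := F^o) (fun k u v => bformPr B k u v z)). Qed.
Lemma bformZl B k x z : bform B (k *: x) z = k * bform B x z.
Proof. exact: (linZ (W := F^o) (f := bform B ^~ z) (fun k u v => bformPl B k u v z)). Qed.
Lemma bformZr B k x z : bform B z (k *: x) = k * bform B z x.
Proof. exact: (linZ (W := F^o) (fun k u v => bformPr B k u v z)). Qed.
Lemma bformNl B x z : bform B (- x) z = - bform B x z.
Proof. exact: (linN (W := F^o) (f := bform B ^~ z) (fun k u v => bformPl B k u v z)). Qed.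
Lemma bformNr B x z : bform B z (- x) = - bform B z x.
Proof. exact: (linN (W := F^o) (fun k u v => bformPr B k u v z)). Qed.
Lemma bform0l B z : bform B 0 z = 0.
Proof. exact: (lin0 (W := F^o) (f := bform B ^~ z) (fun k u v => bformPl B k u v z)). Qed.
Lemma bform0r B z : bform B z 0 = 0.
Proof. exact: (lin0 (W := F^o) (fun k u v => bformPr B k u v z)). Qed.
Lemma bform_suml B z I (r : seq I) (P : pred I) (E : I -> 'rV[F]_m) :
  bform B (\sum_(i <- r | P i) E i) z = \sum_(i <- r | P i) bform B (E i) z.
Proof. exact: (lin_sum (W := F^o) (f := bform B ^~ z) (fun k u v => bformPl B k u v z)). Qed.
Lemma bform_sumr B z I (r : seq I) (P : pred I) (E : I -> 'rV[F]_m) :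
  bform B z (\sum_(i <- r | P i) E i) = \sum_(i <- r | P i) bform B z (E i).
Proof. exact: (lin_sum (W := F^o) (fun k u v => bformPr B k u v z)). Qed.

Lemma bformE B x y : bform B x y = (x *m B *m y^T) 0 0.
Proof.
rewrite /bform mxE exchange_big /=; apply: eq_bigr => j _.
by rewrite !mxE mulr_suml.
Qed.

Lemma bformC B : B^T = B -> forall x y, bform B x y = bform B y x.
Proof.
move=> Bsym x y; rewrite /bform exchange_big /=; apply: eq_bigr => j _.
apply: eq_bigr => i _; rewrite -{1}Bsym mxE; ring.
Qed.

Lemma bilinC c : (forall x, bilin c x x = 0) -> forall x y, bilin c y x = - bilin c x y.
Proof.
move=> alt x y; apply/eqP; rewrite -addr_eq0 addrC; apply/eqP.
by have := alt (x + y); rewrite bilinDl !bilinDr !alt add0r addr0.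
Qed.

End Bilinear.

Lemma torsionPl (F : fieldType) (N : nat) (E c : 'I_N -> 'I_N -> 'rV[F]_N) k x y z :
  torsion E c (k *: x + y) z = k *: torsion E c x z + torsion E c y z.
Proof.
rewrite /torsion !(bilinPl, bilinPr).
by apply/rowP => i; rewrite !mxE; ring.
Qed.

Lemma torsionPr (F : fieldType) (N : nat) (E c : 'I_N -> 'I_N -> 'rV[F]_N) k x y z :
  torsion E c z (k *: x + y) = k *: torsion E c z x + torsion E c z y.
Proof.
rewrite /torsion !(bilinPl, bilinPr).
by apply/rowP => i; rewrite !mxE; ring.
Qed.

Definition nijenhuis (F : fieldType) (m : nat) (c : 'I_m -> 'I_m -> 'rV[F]_m)
    (J : 'M[F]_m) (x y : 'rV[F]_m) : 'rV[F]_m :=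
  bilin c (x *m J) (y *m J) - bilin c (x *m J) y *m J
  - bilin c x (y *m J) *m J - bilin c x y.

Lemma nijenhuisPl (F : fieldType) (m : nat) (c : 'I_m -> 'I_m -> 'rV[F]_m) J k x y z :
  nijenhuis c J (k *: x + y) z = k *: nijenhuis c J x z + nijenhuis c J y z.
Proof.
rewrite /nijenhuis !mulmxDl -!scalemxAl !bilinPl !mulmxDl -!scalemxAl.
by rewrite !scalerBr !opprD [RHS]addrACA [X in _ = X + _]addrACA [X in _ = X + _ + _]addrACA.
Qed.

Lemma nijenhuisPr (F : fieldType) (m : nat) (c : 'I_m -> 'I_m -> 'rV[F]_m) J k x y z :
  nijenhuis c J z (k *: x + y) = k *: nijenhuis c J z x + nijenhuis c J z y.
Proof.
rewrite /nijenhuis !mulmxDl -!scalemxAl !bilinPr !mulmxDl -!scalemxAl.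
by rewrite !scalerBr !opprD [RHS]addrACA [X in _ = X + _]addrACA [X in _ = X + _ + _]addrACA.
Qed.

Lemma curvPm (F : fieldType) (m : nat) (D br : 'I_m -> 'I_m -> 'rV[F]_m) a b k x y :
  curv D br a (k *: x + y) b = k *: curv D br a x b + curv D br a y b.
Proof.
rewrite /curv !(bilinPl, bilinPr).
by apply/rowP => i; rewrite !mxE; ring.
Qed.

Ltac by_linearity :=
  by intros; cbv beta; rewrite ?(bilinPl, bilinPr, bformPl, bformPr); ring.

(** * Traces through the metrically dual basis *)

Section DualBasis.
Variables (F : fieldType) (m : nat) (G : 'M[F]_m).
Hypotheses (Gsym : G^T = G) (Gunit : G \in unitmx).
Local Notation g := (bform G).

(** The [G]-dual basis: a double sum weighted by [invmx G] becomes a single sum over the pairs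
    [ev i], [dual_ev i]. *)
Definition dual_ev (i : 'I_m) : 'rV[F]_m := \sum_j invmx G i j *: ev j.

Lemma invG_sym i j : invmx G i j = invmx G j i.
Proof. by rewrite -{1}Gsym -trmx_inv mxE. Qed.

Lemma dual_evE i : dual_ev i = row i (invmx G).
Proof. by rewrite /dual_ev [RHS]row_sum_delta; apply: eq_bigr => j _; rewrite mxE. Qed.

Lemma bform_dual_ev u i : g u (dual_ev i) = u 0 i.
Proof.
rewrite bformE dual_evE tr_row trmx_inv Gsym colE -!mulmxA (mulmxA G) mulmxV //.
by rewrite mul1mx -colE mxE.
Qed.

Section Contract.
Variables (f : 'rV[F]_m -> F) (u : 'rV[F]_m).
Hypothesis fP : forall k x y, f (k *: x + y) = k * f x + f y.

Lemma contract_dual : \sum_i g u (dual_ev i) * f (ev i) = f u.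
Proof.
rewrite [RHS](lin_ev (W := F^o) fP); apply: eq_bigr => i _.
by rewrite bform_dual_ev.
Qed.

Lemma contract_ev : \sum_i g u (ev i) * f (dual_ev i) = f u.
Proof.
rewrite -contract_dual.
under eq_bigr => i _.
  rewrite /dual_ev (lin_sum (W := F^o) fP) mulr_sumr.
  under eq_bigr => j _ do rewrite (linZ (W := F^o) fP).
  over.
rewrite exchange_big /=; apply: eq_bigr => i _.
rewrite /dual_ev bform_sumr mulr_suml; apply: eq_bigr => j _.
rewrite bformZr invG_sym [in LHS]/GRing.scale /=; ring.
Qed.
End Contract.

(** The inverse Gram matrix is symmetric, so either slot of a trace may carry the dual basis. *)
Lemma contractC (f : 'rV[F]_m -> 'rV[F]_m -> F) :
  (forall k x y z, f (k *: x + y) z = k * f x z + f y z) ->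
  (forall k x y z, f z (k *: x + y) = k * f z x + f z y) ->
  \sum_i f (ev i) (dual_ev i) = \sum_i f (dual_ev i) (ev i).
Proof.
move=> fl fr.
under eq_bigr => i _.
  rewrite /dual_ev (lin_sum (W := F^o) (fun k x y => fr k x y _)).
  under eq_bigr => j _ do rewrite (linZ (W := F^o) (fun k x y => fr k x y _)).
  over.
rewrite exchange_big /=; apply: eq_bigr => i _.
rewrite /dual_ev (lin_sum (W := F^o) (f := f ^~ _) (fun k x y => fl k x y _)).
apply: eq_bigr => j _.
rewrite (linZ (W := F^o) (f := f ^~ _) (fun k x y => fl k x y _)).
by rewrite invG_sym.
Qed.

End DualBasis.

(** In a full-rank factorisation [A = C R], the hypothesis reads [C (R C) R = 0]. Cancelling [C] on
    the left and [R] on the right gives [R C = 0], whose trace is that of [A]. *)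
Lemma mxtrace_square_zero (F : fieldType) (m : nat) (A : 'M[F]_m) :
  A *m A = 0 -> \tr A = 0.
Proof.
move=> A2; rewrite -(mulmx_base A) mxtrace_mulC.
suff -> : row_base A *m col_base A = 0 by rewrite mxtrace0.
have fR : row_free (row_base A) by exact: row_base_free.
have fC : row_full (col_base A) by exact: col_base_full.
apply: (row_free_inj fR); rewrite mul0mx.
have [X XC] := row_fullP fC.
rewrite -[LHS]mul1mx -XC.
have -> : X *m col_base A *m (row_base A *m col_base A *m row_base A) =
    X *m ((col_base A *m row_base A) *m (col_base A *m row_base A)) by rewrite !mulmxA.
by rewrite mulmx_base A2 mulmx0.
Qed.

(** * Ricci curvature of 2-step nilpotent metric Lie algebras *)

(** Taken over an arbitrary field so that one formula serves the real metric and its complex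
    bilinear extension; [ricciE] identifies it with the Ricci tensor. *)
Definition nil_ricci (F : fieldType) (m : nat) (br : 'I_m -> 'I_m -> 'rV[F]_m)
    (G : 'M[F]_m) (x y : 'rV[F]_m) : F :=
  - 2%:R^-1 * (\sum_i bform G (bilin br x (ev i)) (bilin br y (dual_ev G i)))
  + 4%:R^-1 * (\sum_i \sum_j bform G (bilin br (ev i) (ev j)) x *
                 bform G (bilin br (dual_ev G i) (dual_ev G j)) y).

Lemma nil_ricciPl (F : fieldType) (m : nat) (br : 'I_m -> 'I_m -> 'rV[F]_m) G k x y z :
  nil_ricci br G (k *: x + y) z = k * nil_ricci br G x z + nil_ricci br G y z.
Proof.
rewrite /nil_ricci; under eq_bigr do rewrite bilinPl bformPl.
under [X in _ + _ * X]eq_bigr do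
  (under eq_bigr do rewrite bformPr mulrDl -mulrA; rewrite big_split -mulr_sumr /=).
rewrite !big_split -!mulr_sumr /=; ring.
Qed.

Lemma nil_ricciPr (F : fieldType) (m : nat) (br : 'I_m -> 'I_m -> 'rV[F]_m) G k x y z :
  nil_ricci br G z (k *: x + y) = k * nil_ricci br G z x + nil_ricci br G z y.
Proof.
rewrite /nil_ricci; under eq_bigr do rewrite bilinPl bformPr.
under [X in _ + _ * X]eq_bigr do
  (under eq_bigr do rewrite bformPr mulrDr mulrCA; rewrite big_split -mulr_sumr /=).
rewrite !big_split -!mulr_sumr /=; ring.
Qed.

(** The metric dual of twice the codifferential of the fundamental form, by [codiff_fformE]; after
    complexification it is [2 i H], by [lee_vectorE]. *)
Definition lee_vector (F : fieldType) (m : nat) (br : 'I_m -> 'I_m -> 'rV[F]_m)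
  (J G : 'M[F]_m) : 'rV[F]_m := \sum_i bilin br (ev i *m J) (dual_ev G i).

Section NilpotentBracket.
Variables (F : fieldType) (m : nat) (br : 'I_m -> 'I_m -> 'rV[F]_m) (G : 'M[F]_m).
Hypotheses (Gsym : G^T = G) (Gunit : G \in unitmx).
Hypothesis br_alt : forall x, bilin br x x = 0.
Hypothesis br_nil : forall x y z, bilin br (bilin br x y) z = 0.
Local Notation g := (bform G).
Local Notation "[ x , y ]" := (bilin br x y).
Local Notation e := ev.
Local Notation ed := (dual_ev G).

Lemma bracket_nil_r x y z : [z, [x, y]] = 0.
Proof. by rewrite (bilinC br_alt) br_nil oppr0. Qed.

(** In a 2-step nilpotent algebra [ad x] has square zero, hence trace zero. *)
Lemma trace_ad x : \sum_i g [x, e i] (ed i) = 0.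
Proof.
pose A := \matrix_i [x, e i].
have mulA u : u *m A = [x, u].
  rewrite mulmx_sum_row (lin_ev (fun k u v => bilinPr br k u v x)).
  by apply: eq_bigr => i _; rewrite rowK.
transitivity (\tr A).
  by apply: eq_bigr => i _; rewrite bform_dual_ev // mxE.
apply: mxtrace_square_zero; apply/row_matrixP => i.
by rewrite row_mul rowK mulA bracket_nil_r row0.
Qed.

Lemma nil_ricciC x y : nil_ricci br G x y = nil_ricci br G y x.
Proof.
rewrite /nil_ricci (contractC Gsym (f := fun u v => g [x, u] [y, v])); try by_linearity.
congr (_ * _ + _ * _); first by apply: eq_bigr => i _; rewrite bformC.
transitivity (\sum_i \sum_j g [e i, ed j] x * g [ed i, e j] y).
  by apply: eq_bigr => i _;
    rewrite (contractC Gsym (f := fun u v => g [e i, u] x * g [ed i, v] y)); try by_linearity.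
rewrite exchange_big [RHS]exchange_big; apply: eq_bigr => j _ /=.
rewrite (contractC Gsym (f := fun u v => g [u, ed j] x * g [v, e j] y)); try by_linearity.
by apply: eq_bigr => i _; rewrite mulrC.
Qed.
End NilpotentBracket.

(** * Levi-Civita connection and Ricci tensor *)

Section RiemannianCurvature.
Variables (R : rcfType) (m : nat) (br L : 'I_m -> 'I_m -> 'rV[R]_m) (G : 'M[R]_m).
Hypotheses (Gsym : G^T = G) (Gunit : G \in unitmx).
Hypothesis br_alt : forall x, bilin br x x = 0.
Hypothesis br_nil : forall x y z, bilin br (bilin br x y) z = 0.
Hypothesis LC : levi_civita br G L.
Local Notation g := (bform G).
Local Notation "[ x , y ]" := (bilin br x y).
Local Notation e := ev.
Local Notation ed := (dual_ev G).

Let gC := bformC Gsym.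
Let brC := bilinC br_alt.

Let br_nil_r := bracket_nil_r br_alt br_nil.
Let trace_ad := trace_ad Gsym Gunit br_alt br_nil.

Lemma koszul x y z :
  2%:R * g (bilin L x y) z = g [x, y] z - g [y, z] x + g [z, x] y.
Proof.
have [tor met] := LC.
have br_L u v : [u, v] = bilin L u v - bilin L v u.
  by have /eqP := tor u v; rewrite /torsion subr_eq0 => /eqP.
rewrite !br_L !(bformDl, bformNl).
have := met x y z; have := met y z x; have := met z x y.
rewrite (gC x) (gC y) (gC z); lra.
Qed.

(** Exchanging the dual pair preserves the trace but reverses the bracket. *)
Lemma trace_bracket_self x : \sum_i g [ed i, e i] x = 0.
Proof.
have E := @contractC _ _ G Gsym (fun u v => g [u, v] x)
  ltac:(by_linearity) ltac:(by_linearity).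
suff : \sum_i g [ed i, e i] x = - \sum_i g [ed i, e i] x by lra.
by rewrite -{1}E -sumrN; apply: eq_bigr => i _; rewrite [X in g X _]brC bformNl.
Qed.

(** This is the divergence of a left-invariant field; the Koszul formula reduces it to traces of
    [ad x] and to [trace_bracket_self]. *)
Lemma trace_levi_civita x : \sum_i g (bilin L (e i) x) (ed i) = 0.
Proof.
have two : 2%:R != 0 :> R by rewrite pnatr_eq0.
apply: (mulfI two); rewrite mulr0 mulr_sumr.
under eq_bigr do rewrite koszul [X in g X _ - _]brC bformNl.
rewrite !big_split /= trace_bracket_self !sumrN trace_ad.
rewrite -(@contractC _ _ G Gsym (fun u v => g [x, u] v)) ?trace_ad ?oppr0 ?addr0 //;
  by_linearity.
Qed.

Lemma ricciE x y : ricci br L x y = nil_ricci br G x y.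
Proof.
have [tor met] := LC.
pose B := \sum_i g [x, e i] [y, ed i].
pose C := \sum_i \sum_j g [e i, e j] x * g [ed i, ed j] y.
have swapB : \sum_i g [y, e i] [x, ed i] = B.
  rewrite (@contractC _ _ G Gsym (fun u v => g [y, u] [x, v])); try by_linearity.
  by apply: eq_bigr => i _; rewrite gC.
(* Metric compatibility turns this into a product of two covariant derivatives, each expanded by
   Koszul. Of the nine products, six feed the value of one bracket into another bracket and vanish.
   The survivors are [a1 b1] and [a2 b3], whose contributions [B] cancel, and [a3 b2], which gives
   [C]. *)
have T2 : \sum_i g (bilin L x (bilin L (e i) y)) (ed i) = - (4%:R^-1 * C).
  pose a1 i j := g [e i, y] (ed j).
  pose a2 i j := g [y, ed j] (e i).
  pose a3 i j := g [ed j, e i] y.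
  pose b1 i j := g [x, ed i] (e j).
  pose b2 i j := g [ed i, e j] x.
  pose b3 i j := g [e j, x] (ed i).
  transitivity (- (4%:R^-1 * \sum_i \sum_j
      (a1 i j - a2 i j + a3 i j) * (b1 i j - b2 i j + b3 i j))).
    rewrite mulr_sumr -sumrN; apply: eq_bigr => i _.
    transitivity (- g (bilin L (e i) y) (bilin L x (ed i))).
      by apply/eqP; rewrite -addr_eq0; apply/eqP/met.
    rewrite -(contract_dual Gsym Gunit (f := fun v => g v (bilin L x (ed i))));
      last by_linearity.
    congr (- _); rewrite mulr_sumr; apply: eq_bigr => j _.
    have := koszul (e i) y (ed j); have := koszul x (ed i) (e j).
    rewrite (gC (e j)) /a1 /a2 /a3 /b1 /b2 /b3 => <- <-.
    by field.
  congr (- (_ * _)).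
  have s11 : \sum_i \sum_j a1 i j * b1 i j = - B.
    rewrite -swapB -sumrN; apply: eq_bigr => i _.
    rewrite (contract_dual Gsym Gunit (f := fun v => g [x, ed i] v)); last by_linearity.
    by rewrite gC [X in g X _]brC bformNl.
  have s12 : \sum_i \sum_j a1 i j * b2 i j = 0.
    apply: big1 => i _.
    rewrite (contract_dual Gsym Gunit (f := fun v => g [ed i, v] x)); last by_linearity.
    by rewrite br_nil_r bform0l.
  have s13 : \sum_i \sum_j a1 i j * b3 i j = 0.
    apply: big1 => i _.
    rewrite (contract_dual Gsym Gunit (f := fun v => g [v, x] (ed i))); last by_linearity.
    by rewrite br_nil bform0l.
  have s21 : \sum_i \sum_j a2 i j * b1 i j = 0.
    rewrite exchange_big; apply: big1 => j _.
    rewrite (contract_ev Gsym Gunit (f := fun v => g [x, v] (e j))); last by_linearity.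
    by rewrite br_nil_r bform0l.
  have s22 : \sum_i \sum_j a2 i j * b2 i j = 0.
    rewrite exchange_big; apply: big1 => j _.
    rewrite (contract_ev Gsym Gunit (f := fun v => g [v, e j] x)); last by_linearity.
    by rewrite br_nil bform0l.
  have s23 : \sum_i \sum_j a2 i j * b3 i j = - B.
    rewrite -sumrN exchange_big; apply: eq_bigr => j _.
    rewrite (contract_ev Gsym Gunit (f := fun v => g [e j, x] v)); last by_linearity.
    by rewrite [X in g X _]brC bformNl.
  have s31 : \sum_i \sum_j a3 i j * b1 i j = 0.
    apply: big1 => i _; under eq_bigr do rewrite mulrC.
    rewrite (contract_ev Gsym Gunit (f := fun v => g [v, e i] y)); last by_linearity.
    by rewrite br_nil bform0l.
  have s32 : \sum_i \sum_j a3 i j * b2 i j = - C.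
    rewrite exchange_big /C [in RHS]exchange_big -sumrN; apply: eq_bigr => j _.
    rewrite (contractC Gsym (f := fun u v => g [ed j, u] y * g [v, e j] x)); try by_linearity.
    rewrite -sumrN; apply: eq_bigr => i _.
    rewrite [X in g X _]brC bformNl; ring.
  have s33 : \sum_i \sum_j a3 i j * b3 i j = 0.
    rewrite exchange_big; apply: big1 => j _; under eq_bigr do rewrite mulrC.
    rewrite (contract_dual Gsym Gunit (f := fun v => g [ed j, v] y)); last by_linearity.
    by rewrite br_nil_r bform0l.
  transitivity (\sum_i \sum_j a1 i j * b1 i j - \sum_i \sum_j a1 i j * b2 i j
    + \sum_i \sum_j a1 i j * b3 i j - \sum_i \sum_j a2 i j * b1 i j
    + \sum_i \sum_j a2 i j * b2 i j - \sum_i \sum_j a2 i j * b3 i j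
    + \sum_i \sum_j a3 i j * b1 i j - \sum_i \sum_j a3 i j * b2 i j
    + \sum_i \sum_j a3 i j * b3 i j).
    rewrite -!sumrN -!big_split /=; apply: eq_bigr => i _.
    rewrite -!sumrN -!big_split /=; apply: eq_bigr => j _; ring.
  rewrite s11 s12 s13 s21 s22 s23 s31 s32 s33; ring.
(* Two of the three Koszul terms are nested brackets; only the middle one remains. *)
have T3 : \sum_i g (bilin L [e i, x] y) (ed i) = 2%:R^-1 * B.
  rewrite mulr_sumr; apply: eq_bigr => i _.
  have := koszul [e i, x] y (ed i).
  rewrite br_nil br_nil_r !bform0l (brC x (e i)) bformNr [g [y, _] _]gC; lra.
rewrite /ricci /nil_ricci -/B -/C.
(* The first sum is the divergence of [bilin L x y], hence zero. *)
transitivity (\sum_i g (bilin L (e i) (bilin L x y)) (ed i)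
   - \sum_i g (bilin L x (bilin L (e i) y)) (ed i)
   - \sum_i g (bilin L [e i, x] y) (ed i)).
  rewrite -!sumrN -!big_split /=; apply: eq_bigr => i _.
  by rewrite -!bformNl -!bformDl bform_dual_ev.
rewrite trace_levi_civita T2 T3; ring.
Qed.

(** * The codifferential of the fundamental form *)

Section Codifferential.
Variable J : 'M[R]_m.
Hypotheses (JJ : J *m J = - 1%:M)
  (gJ : forall x y, g (x *m J) (y *m J) = g x y).

Lemma bform_J_skew x y : g (x *m J) y = - g x (y *m J).
Proof. by rewrite -(gJ (x *m J)) -mulmxA JJ mulmxN mulmx1 bformNl. Qed.

(** Expanding the first slot in the basis and reassembling in the second moves [J] across [g], for
    which it is skew. *)
Lemma contract_J_skew (f : 'rV[R]_m -> 'rV[R]_m -> R) :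
  (forall k x y z, f (k *: x + y) z = k * f x z + f y z) ->
  (forall k x y z, f z (k *: x + y) = k * f z x + f z y) ->
  \sum_i f (e i *m J) (ed i) = - \sum_i f (e i) (ed i *m J).
Proof.
move=> fl fr.
under eq_bigr => i _.
  rewrite -(contract_dual Gsym Gunit (f := f ^~ (ed i)) _ (fun k x y => fl k x y _)).
  over.
rewrite exchange_big -sumrN; apply: eq_bigr => k _ /=.
rewrite -(contract_ev Gsym Gunit (ed k *m J) (fun a x y => fr a x y _)) -sumrN.
by apply: eq_bigr => i _; rewrite bform_J_skew gC mulNr.
Qed.

(** Of the two traces, the first is the divergence of [x *m J] and vanishes. In the second, Koszul
    gives three terms, and two of them cancel because [J] is skew ([swap]). *)
Lemma codiff_fformE x : codiff_fform J G L x = 2%:R^-1 * g (lee_vector br J G) x.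
Proof.
have [_ met] := LC.
transitivity (\sum_i g (bilin L (e i) (ed i) *m J) x
              + \sum_i g (ed i *m J) (bilin L (e i) x)).
  rewrite /codiff_fform -sumrN -big_split; apply: eq_bigr => i _ /=.
  have P k u v :
    g (bilin L (e i) (k *: u + v) *m J) x + g ((k *: u + v) *m J) (bilin L (e i) x)
    = k * (g (bilin L (e i) u *m J) x + g (u *m J) (bilin L (e i) x))
      + (g (bilin L (e i) v *m J) x + g (v *m J) (bilin L (e i) x)).
    by rewrite bilinPr !mulmxDl -!scalemxAl !bformPl; ring.
  rewrite /dual_ev (lin_sum (W := R^o) P) -sumrN; apply: eq_bigr => j _.
  by rewrite (linZ (W := R^o) P) /fform -[_ *: _]/(_ * _); ring.
have -> : \sum_i g (bilin L (e i) (ed i) *m J) x = 0.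
  rewrite -[RHS](trace_levi_civita (x *m J)); apply: eq_bigr => i _.
  rewrite bform_J_skew [RHS]gC; have := met (e i) (ed i) (x *m J); lra.
rewrite add0r.
have swap : \sum_i g [x, ed i *m J] (e i) = \sum_i g [e i, x] (ed i *m J).
  have P k u v : (k *: u + v) *m J = k *: (u *m J) + v *m J.
    by rewrite mulmxDl scalemxAl.
  rewrite (contractC Gsym (f := fun v u => g [x, u *m J] v));
    try by intros; rewrite ?P; by_linearity.
  rewrite (contract_J_skew (f := fun u v => g [x, u] v)); try by_linearity.
  by rewrite -sumrN; apply: eq_bigr => i _; rewrite [X in - g X _]brC bformNl opprK.
have -> : g (lee_vector br J G) x = \sum_i g [ed i *m J, e i] x.
  rewrite /lee_vector bform_suml (contractC Gsym (f := fun u v => g [u *m J, v] x)) //.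
    by intros; rewrite mulmxDl -scalemxAl; by_linearity.
  by by_linearity.
apply: (mulfI (_ : 2%:R != 0)); first by rewrite pnatr_eq0.
rewrite mulrA mulfV ?pnatr_eq0 // mul1r mulr_sumr.
under eq_bigr do rewrite gC koszul.
by rewrite !big_split sumrN /= swap subrr add0r.
Qed.
End Codifferential.
End RiemannianCurvature.

(** * The Chern connection in a frame of type (1,0) *)

Section DualFrame.
Variables (F : fieldType) (m n : nat) (h : 'M[F]_n) (Z Zb : 'I_n -> 'rV[F]_m).

(** Here [h r s] stands for the inverse metric with barred index [r] first, so that contracting with
    [h] amounts to replacing [Zb] by the dual (0,1) frame. *)
Definition dual_frame s : 'rV[F]_m := \sum_r h r s *: Zb r.
Local Notation Zd := dual_frame.

Lemma contract_frame (f : 'rV[F]_m -> 'rV[F]_m -> F) :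
  (forall k x y z, f z (k *: x + y) = k * f z x + f z y) ->
  \sum_r \sum_s h r s * f (Z s) (Zb r) = \sum_s f (Z s) (Zd s).
Proof.
move=> fr; rewrite exchange_big; apply: eq_bigr => s _ /=.
rewrite /dual_frame (lin_sum (W := F^o) (fun k x y => fr k x y _)).
by apply: eq_bigr => r _; rewrite (linZ (W := F^o) (fun k x y => fr k x y _)).
Qed.

Lemma contract_frame2 (f : 'rV[F]_m -> 'rV[F]_m -> 'rV[F]_m -> 'rV[F]_m -> F) :
  (forall k x y a b c, f a (k *: x + y) b c = k * f a x b c + f a y b c) ->
  (forall k x y a b c, f a b c (k *: x + y) = k * f a b c x + f a b c y) ->
  \sum_p \sum_q \sum_r \sum_s h p q * h r s * f (Z q) (Zb p) (Z s) (Zb r)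
  = \sum_q \sum_s f (Z q) (Zd q) (Z s) (Zd s).
Proof.
move=> f2 f4.
rewrite -(contract_frame (f := fun u v => \sum_s f u v (Z s) (Zd s))).
  apply: eq_bigr => p _; apply: eq_bigr => q _.
  rewrite -(contract_frame (f := f (Z q) (Zb p))) => [|k x y z]; last exact: f4.
  rewrite mulr_sumr; apply: eq_bigr => r _; rewrite mulr_sumr.
  by apply: eq_bigr => s _; rewrite mulrA.
move=> k x y z; rewrite mulr_sumr -big_split; apply: eq_bigr => s _.
exact: f2.
Qed.
End DualFrame.

Section ComplexFrame.
Variables (F : fieldType) (m n : nat) (I : F).
Variables (br D : 'I_m -> 'I_m -> 'rV[F]_m) (J G : 'M[F]_m).
Variables (Z Zd : 'I_n -> 'rV[F]_m).
Local Notation g := (bform G).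
Local Notation "[ x , y ]" := (bilin br x y).

(** Projections onto types (1,0) and (0,1), the eigenspaces of [J] for [I] and [- I]. With [I] an
    abstract square root of -1, the computation needs no complex conjugation. *)
Definition proj10 : 'M[F]_m := 2%:R^-1 *: (1%:M - I *: J).
Definition proj01 : 'M[F]_m := 2%:R^-1 *: (1%:M + I *: J).
Local Notation p := proj10.
Local Notation pb := proj01.
Definition eig (k : F) (x : 'rV[F]_m) := x *m J = k *: x.

Hypotheses (two_neq0 : 2%:R != 0 :> F) (ii : I * I = -1).
Hypotheses (Gsym : G^T = G) (Gunit : G \in unitmx) (JJ : J *m J = - 1%:M)
  (gJ : forall x y, g (x *m J) (y *m J) = g x y).
Hypotheses (br_alt : forall x, [x, x] = 0)
  (br_nil : forall x y z, [[x, y], z] = 0)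
  (br_nilJ : forall x y z, [[x, y] *m J, z] = 0)
  (br_int : forall x y, [x *m J, y *m J] - [x *m J, y] *m J - [x, y *m J] *m J - [x, y] = 0).
Hypotheses (Dmet : forall x y z, g (bilin D x y) z + g y (bilin D x z) = 0)
  (DJ : forall x y, bilin D x (y *m J) = bilin D x y *m J)
  (Dtor : forall x y, torsion D br (x *m J) (y *m J) = - torsion D br x y).
Hypotheses (Z10 : forall s, eig I (Z s)) (Zd01 : forall s, eig (- I) (Zd s))
  (resZ : forall u, \sum_s g u (Zd s) *: Z s = u *m p)
  (resZd : forall u, \sum_s g (Z s) u *: Zd s = u *m pb).

Implicit Types (u v x y : 'rV[F]_m) (k l : F).

Let gC := bformC Gsym.
Let brC := bilinC br_alt.

Lemma four_neq0 : 4%:R != 0 :> F.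
Proof. by rewrite (natrM F 2 2) mulf_neq0. Qed.

Lemma eq_opp0 (V : lmodType F) (x : V) : x = - x -> x = 0.
Proof.
move=> /eqP; rewrite -addr_eq0 -mulr2n -scaler_nat scaler_eq0 (negPf two_neq0).
by move/eqP.
Qed.

Lemma mul_p u : u *m p = 2%:R^-1 *: (u - I *: (u *m J)).
Proof. by rewrite /proj10 -scalemxAr mulmxBr mulmx1 -scalemxAr. Qed.

Lemma mul_pb u : u *m pb = 2%:R^-1 *: (u + I *: (u *m J)).
Proof. by rewrite /proj01 -scalemxAr mulmxDr mulmx1 -scalemxAr. Qed.

Lemma proj_sum u : u *m p + u *m pb = u.
Proof.
rewrite mul_p mul_pb -scalerDr addrACA addNr addr0 -mulr2n -[u *+ 2]scaler_nat.
by rewrite scalerA mulVf ?two_neq0 ?scale1r.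
Qed.

Lemma mulJJ (u : 'rV[F]_m) : u *m J *m J = - u.
Proof. by rewrite -mulmxA JJ mulmxN mulmx1. Qed.

Lemma eig_p u : eig I (u *m p).
Proof.
rewrite /eig mul_p -scalemxAl mulmxBl -scalemxAl mulJJ scalerA [_ * 2%:R^-1]mulrC.
rewrite -scalerA; congr (_ *: _).
by rewrite scalerBr scalerA ii scaleN1r scalerN !opprK addrC.
Qed.

Lemma eig_pb u : eig (- I) (u *m pb).
Proof.
rewrite /eig mul_pb -scalemxAl mulmxDl -scalemxAl mulJJ scalerA [_ * 2%:R^-1]mulrC.
rewrite -scalerA; congr (_ *: _).
by rewrite scalerDr scalerA mulNr ii opprK scale1r scalerN scaleNr addrC.
Qed.

(** Covers both [(I, - I)] and [(- I, I)], so each statement about the Chern connection comes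
    together with its conjugate. *)
Definition opposite_eig (k l : F) := [/\ k * k = -1, l * l = -1 & k * l = 1].

Lemma opp_iNi : opposite_eig I (- I).
Proof. by split; rewrite ?mulrNN ?mulrN ?ii ?opprK. Qed.
Lemma opp_Nii : opposite_eig (- I) I.
Proof. by split; rewrite ?mulrNN ?mulNr ?ii ?opprK. Qed.

(** Invariance under [J] gives [g x y = k^2 g x y = - g x y]. *)
Lemma eig_orth k x y : k * k = -1 -> eig k x -> eig k y -> g x y = 0.
Proof.
move=> kk ex ey; apply: (@eq_opp0 F^o).
by rewrite -{1}gJ ex ey bformZl bformZr mulrA kk mulN1r.
Qed.

Lemma g_pb x u : eig I x -> g x (u *m pb) = g x u.
Proof.
by move=> ex; rewrite -{2}(proj_sum u) bformDr (eig_orth ii ex (eig_p u)) add0r.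
Qed.

Lemma g_p x u : eig (- I) x -> g x (u *m p) = g x u.
Proof.
have [_ kk _] := opp_iNi.
by move=> ex; rewrite -{2}(proj_sum u) bformDr (eig_orth kk ex (eig_pb u)) addr0.
Qed.

(** Centrality of [J [g, g]] enters here and in [br_pb]: both type components of a bracket are
    central. *)
Lemma br_p x y z : [[x, y] *m p, z] = 0.
Proof.
by rewrite mul_p bilinZl bilinDl bilinNl bilinZl br_nil br_nilJ scaler0 subrr scaler0.
Qed.

Lemma br_pb x y z : [[x, y] *m pb, z] = 0.
Proof.
by rewrite mul_pb bilinZl bilinDl bilinZl br_nil br_nilJ scaler0 addr0 scaler0.
Qed.

(** On two vectors of the same type the Nijenhuis tensor is [-2 ([x, y] + k J [x, y])]. *)
Lemma br_eig k x y : k * k = -1 -> eig k x -> eig k y -> eig k [x, y].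
Proof.
move=> kk ex ey; have := br_int x y.
rewrite ex ey !(bilinZl, bilinZr) scalerA kk -scalemxAl scaleN1r /eig => E.
have : [x, y] + k *: ([x, y] *m J) = 0.
  apply: (@eq_opp0 _); rewrite -[LHS]addr0 -E opprD addrACA -!addrA.
  apply/matrixP => a b; rewrite !mxE; ring.
move/(congr1 (fun v => k *: v)); rewrite scalerDr scalerA kk scaleN1r scaler0.
by move/eqP; rewrite subr_eq0 => /eqP <-.
Qed.

Section Contract.
Variables (f : 'rV[F]_m -> F) (u : 'rV[F]_m).
Hypothesis fP : forall k x y, f (k *: x + y) = k * f x + f y.

Lemma contract_Z : \sum_s g u (Zd s) * f (Z s) = f (u *m p).
Proof.
rewrite -resZ (lin_sum (W := F^o) fP); apply: eq_bigr => s _.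
by rewrite (linZ (W := F^o) fP).
Qed.

Lemma contract_Zd : \sum_s g (Z s) u * f (Zd s) = f (u *m pb).
Proof.
rewrite -resZd (lin_sum (W := F^o) fP); apply: eq_bigr => s _.
by rewrite (linZ (W := F^o) fP).
Qed.
End Contract.

(** Split the second slot by type, expand each part in its frame, and contract the remaining sum
    over the real basis. *)
Lemma trace_split (f : 'rV[F]_m -> 'rV[F]_m -> F) :
  (forall k x y z, f (k *: x + y) z = k * f x z + f y z) ->
  (forall k x y z, f z (k *: x + y) = k * f z x + f z y) ->
  \sum_i f (ev i) (dual_ev G i) = \sum_s f (Z s) (Zd s) + \sum_s f (Zd s) (Z s).
Proof.
move=> fl fr.
transitivity (\sum_i (\sum_s g (Z s) (dual_ev G i) * f (ev i) (Zd s)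
                    + \sum_s g (dual_ev G i) (Zd s) * f (ev i) (Z s))).
  apply: eq_bigr => i _.
  rewrite (contract_Z _ (fun k x y => fr k x y _)) (contract_Zd _ (fun k x y => fr k x y _)).
  by rewrite -(linD (W := F^o) (fun k x y => fr k x y _)) addrC proj_sum.
rewrite big_split /= exchange_big [X in _ + X]exchange_big /=; congr (_ + _).
  by apply: eq_bigr => s _; rewrite (contract_dual Gsym Gunit _ (fun k x y => fl k x y _)).
apply: eq_bigr => s _; under eq_bigr do rewrite gC.
by rewrite (contract_dual Gsym Gunit _ (fun k x y => fl k x y _)).
Qed.

(** As [k l = 1], replacing [a, c] by [J a, J c] fixes their torsion, while [Dtor] negates it. Hence
    mixed torsion is zero. *)
Lemma torsion_mixed k l a c : opposite_eig k l -> eig k a -> eig l c ->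
  bilin D a c - bilin D c a = [a, c].
Proof.
case=> kk ll kl ea ec; apply/eqP; rewrite -subr_eq0; apply/eqP.
apply: (@eq_opp0 _); rewrite -[RHS]Dtor ea ec /torsion !(bilinZl, bilinZr) !scalerA.
by rewrite [l * k]mulrC kl !scale1r.
Qed.

Lemma D_eig k a x : eig k a -> eig k (bilin D x a).
Proof. by move=> ea; rewrite /eig -DJ ea bilinZr. Qed.

(** Metricity moves [D] along [a] onto [c]; then [D_a c = [a, c] + D_c a], and [D_c a] has the type
    of [b], so it is orthogonal to [b]. *)
Lemma chern_same k l a b c : opposite_eig k l -> eig k a -> eig k b -> eig l c ->
  g (bilin D a b) c = - g b [a, c].
Proof.
move=> kl ea eb ec; rewrite -(torsion_mixed kl ea ec) bformDr bformNr.
case: kl => kk _ _; rewrite (eig_orth kk eb (D_eig c ea)) subr0.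
by apply/eqP; rewrite -addr_eq0 Dmet.
Qed.

Lemma chern_mixed k l a c c' : opposite_eig k l -> eig k a -> eig l c -> eig l c' ->
  g (bilin D c a) c' = g [c, a] c'.
Proof.
move=> kl ea ec ec'; rewrite brC -(torsion_mixed kl ea ec) opprB bformDl bformNl.
by case: kl => _ ll _; rewrite (eig_orth ll (D_eig a ec) ec') subr0.
Qed.

(** The Chern torsion component in terms of the bracket alone, valid when [x], [y] share a type and
    [u] has the opposite one ([torsionE]). *)
Definition tau x y u : F := - g y [x, u] + g x [y, u] - g [x, y] u.

Lemma torsionE k l a b c : opposite_eig k l -> eig k a -> eig k b -> eig l c ->
  g (torsion D br a b) c = tau a b c.
Proof.
move=> kl ea eb ec; rewrite /torsion !(bformDl, bformNl).
by rewrite (chern_same kl ea eb ec) (chern_same kl eb ea ec) opprK.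
Qed.

(** * The tensors S, Q^1 and Q^2 as quadratic expressions in the bracket *)

Section Tensors.
Variables z w : 'rV[F]_m.
Hypotheses (z10 : eig I z) (w01 : eig (- I) w).

(** The [B] terms pair the values of two brackets, the [C] terms their arguments. [B2] and [B3]
    separate one such sum by the type of [[z, Zd s]]. *)
Let B1 := \sum_s g [z, Z s] [w, Zd s].
Let B2 := \sum_s g ([z, Zd s] *m p) [w, Z s].
Let B3 := \sum_s g ([z, Zd s] *m pb) [w, Z s].
Let C1 := \sum_s \sum_t g [Zd s, Zd t] z * g [Z s, Z t] w.
Let C2 := \sum_s \sum_t g [Z s, Zd t] z * g [Zd s, Z t] w.

Lemma D_br_p x y : g (bilin D ([x, y] *m p) z) w = 0.
Proof. by rewrite (chern_same opp_iNi (eig_p _) z10 w01) br_p bform0r oppr0. Qed.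
Lemma D_br_pb x y : g (bilin D ([x, y] *m pb) z) w = 0.
Proof. by rewrite (chern_mixed opp_iNi z10 (eig_pb _) w01) br_pb bform0l. Qed.

Lemma D_br x y : g (bilin D [x, y] z) w = 0.
Proof.
have := congr1 (fun v => g (bilin D v z) w) (proj_sum [x, y]).
by rewrite bilinDl bformDl D_br_p D_br_pb addr0 => <-.
Qed.

(** The derivative along a bracket drops out by [D_br]. Metricity makes the other two terms products
    of first derivatives: mixed types give [B2], equal types give [C2]. *)
Lemma chern_ricci2E : \sum_s g (curv D br (Z s) (Zd s) z) w = - B2 + C2.
Proof.
rewrite -sumrN -big_split; apply: eq_bigr => s _ /=.
rewrite /curv !(bformDl, bformNl).
rewrite D_br.
have DmetN x y u : g (bilin D x y) u = - g y (bilin D x u).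
  by apply/eqP; rewrite -addr_eq0 Dmet.
rewrite subr0; congr (_ + _).
  rewrite DmetN (chern_mixed opp_iNi z10 (Zd01 s) (D_eig _ w01)).
  rewrite gC -(g_p _ (D_eig _ w01)) (chern_mixed opp_Nii w01 (Z10 s) (eig_p _)).
  by rewrite brC [X in X *m p]brC mulNmx bformNl bformNr opprK gC.
rewrite DmetN opprK gC -(g_p _ (D_eig _ w01)) gC.
rewrite -(contract_Z (bilin D (Z s) z) (f := fun v => g v (bilin D (Zd s) w)));
  last by_linearity.
apply: eq_bigr => t _; rewrite (chern_same opp_iNi (Z10 s) z10 (Zd01 t)).
rewrite [g (Z t) _]gC (chern_same opp_Nii (Zd01 s) w01 (Z10 t)) mulrNN.
by rewrite gC [X in _ * X]gC.
Qed.

(* Here and in [torsion_sq2E], each cross term contracts a bracket against an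
   argument of another bracket, which vanishes because [[g, g] + J [g, g]] is
   central; only the three diagonal products survive. *)
Lemma torsion_sq1E :
  \sum_q \sum_s tau z (Z s) (Zd q) * tau w (Zd s) (Z q) = B3 + C2 + B1.
Proof.
pose a1 q s := g (Z s) [z, Zd q].
pose a2 q s := g z [Z s, Zd q].
pose a3 q s := g [z, Z s] (Zd q).
pose b1 q s := g (Zd s) [w, Z q].
pose b2 q s := g w [Zd s, Z q].
pose b3 q s := g [w, Zd s] (Z q).
have s11 : \sum_q \sum_s a1 q s * b1 q s = B3.
  apply: eq_bigr => q _.
  rewrite (contract_Zd [z, Zd q] (f := fun v => g v [w, Z q])) //; by_linearity.
have s12 : \sum_q \sum_s a1 q s * b2 q s = 0.
  apply: big1 => q _.
  rewrite (contract_Zd [z, Zd q] (f := fun v => g w [v, Z q])); last by_linearity.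
  by rewrite br_pb bform0r.
have s13 : \sum_q \sum_s a1 q s * b3 q s = 0.
  apply: big1 => q _.
  rewrite (contract_Zd [z, Zd q] (f := fun v => g [w, v] (Z q))); last by_linearity.
  by rewrite brC br_pb oppr0 bform0l.
have s21 : \sum_q \sum_s a2 q s * b1 q s = 0.
  apply: big1 => q _; under eq_bigr do rewrite mulrC /b1 gC.
  rewrite (contract_Z [w, Z q] (f := fun v => g z [v, Zd q])); last by_linearity.
  by rewrite br_p bform0r.
have s22 : \sum_q \sum_s a2 q s * b2 q s = C2.
  rewrite /C2 exchange_big; apply: eq_bigr => q _; apply: eq_bigr => s _.
  by rewrite /a2 /b2 gC [X in _ * X]gC.
have s23 : \sum_q \sum_s a2 q s * b3 q s = 0.
  rewrite exchange_big /=; apply: big1 => s _; under eq_bigr do rewrite mulrC /b3 gC.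
  rewrite (contract_Zd [w, Zd s] (f := fun v => g z [Z s, v])); last by_linearity.
  by rewrite brC br_pb oppr0 bform0r.
have s31 : \sum_q \sum_s a3 q s * b1 q s = 0.
  apply: big1 => q _; under eq_bigr do rewrite mulrC /b1 gC.
  rewrite (contract_Z [w, Z q] (f := fun v => g [z, v] (Zd q))); last by_linearity.
  by rewrite brC br_p oppr0 bform0l.
have s32 : \sum_q \sum_s a3 q s * b2 q s = 0.
  rewrite exchange_big; apply: big1 => s _.
  rewrite (contract_Z [z, Z s] (f := fun v => g w [Zd s, v])); last by_linearity.
  by rewrite brC br_p oppr0 bform0r.
have s33 : \sum_q \sum_s a3 q s * b3 q s = B1.
  rewrite exchange_big; apply: eq_bigr => s _.
  rewrite (contract_Z [z, Z s] (f := fun v => g [w, Zd s] v)); last by_linearity.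
  (* By integrability [[w, Zd s]] is of type (0,1), so projecting the other factor to (1,0) changes
     nothing. *)
  have [_ kk _] := opp_iNi.
  by rewrite (g_p _ (br_eig kk w01 (Zd01 s))) gC.
transitivity (\sum_q \sum_s a1 q s * b1 q s - \sum_q \sum_s a1 q s * b2 q s
    + \sum_q \sum_s a1 q s * b3 q s - \sum_q \sum_s a2 q s * b1 q s
    + \sum_q \sum_s a2 q s * b2 q s - \sum_q \sum_s a2 q s * b3 q s
    + \sum_q \sum_s a3 q s * b1 q s - \sum_q \sum_s a3 q s * b2 q s
    + \sum_q \sum_s a3 q s * b3 q s).
  rewrite -!sumrN -!big_split /=; apply: eq_bigr => q _.
  rewrite -!sumrN -!big_split /=; apply: eq_bigr => s _.
  by rewrite /tau -/(a1 q s) -/(a2 q s) -/(a3 q s) -/(b1 q s) -/(b2 q s) -/(b3 q s); ring.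
rewrite s11 s12 s13 s21 s22 s23 s31 s32 s33; ring.
Qed.

Lemma torsion_sq2E :
  \sum_q \sum_s tau (Z s) (Z q) w * tau (Zd s) (Zd q) z = 2%:R * B2 + C1.
Proof.
(* The first two terms of [tau] are transposes of each other up to sign, so [a1 s q] plays the part
   of [a2] and [B2] occurs twice. *)
pose a1 q s := g (Z q) [Z s, w].
pose a3 q s := g [Z s, Z q] w.
pose b1 q s := g (Zd q) [Zd s, z].
pose b3 q s := g [Zd s, Zd q] z.
have s11 : \sum_q \sum_s a1 q s * b1 q s = B2.
  rewrite exchange_big; apply: eq_bigr => s _.
  rewrite (contract_Zd [Z s, w] (f := fun v => g v [Zd s, z])); last by_linearity.
  rewrite brC mulNmx [[Zd s, z]]brC bformNl bformNr opprK gC.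
  rewrite -{1}(proj_sum [z, Zd s]) bformDl.
  rewrite [X in _ + X](eig_orth (k := - I)) ?addr0; last first.
  - exact: eig_pb.
  - exact: eig_pb.
  - by have [] := opp_iNi.
  - by rewrite g_pb //; exact: eig_p.
have s22 : \sum_q \sum_s a1 s q * b1 s q = B2 by rewrite exchange_big.
have s12 : \sum_q \sum_s a1 q s * b1 s q = 0.
  rewrite exchange_big; apply: big1 => s _.
  rewrite (contract_Zd [Z s, w] (f := fun v => g (Zd s) [v, z])); last by_linearity.
  by rewrite br_pb bform0r.
have s21 : \sum_q \sum_s a1 s q * b1 q s = 0 by rewrite exchange_big.
have s13 : \sum_q \sum_s a1 q s * b3 q s = 0.
  rewrite exchange_big; apply: big1 => s _.
  rewrite (contract_Zd [Z s, w] (f := fun v => g [Zd s, v] z)); last by_linearity.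
  by rewrite brC br_pb oppr0 bform0l.
have s23 : \sum_q \sum_s a1 s q * b3 q s = 0.
  apply: big1 => q _.
  rewrite (contract_Zd [Z q, w] (f := fun v => g [v, Zd q] z)); last by_linearity.
  by rewrite br_pb bform0l.
have s31 : \sum_q \sum_s a3 q s * b1 q s = 0.
  rewrite exchange_big /=; apply: big1 => s _; under eq_bigr do rewrite mulrC /b1 gC.
  rewrite (contract_Z [Zd s, z] (f := fun v => g [Z s, v] w)); last by_linearity.
  by rewrite brC br_p oppr0 bform0l.
have s32 : \sum_q \sum_s a3 q s * b1 s q = 0.
  apply: big1 => q _; under eq_bigr do rewrite mulrC /b1 gC.
  rewrite (contract_Z [Zd q, z] (f := fun v => g [v, Z q] w)); last by_linearity.
  by rewrite br_p bform0l.
have s33 : \sum_q \sum_s a3 q s * b3 q s = C1.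
  rewrite /C1 exchange_big; apply: eq_bigr => s _; apply: eq_bigr => q _.
  by rewrite mulrC.
transitivity (\sum_q \sum_s a1 q s * b1 q s - \sum_q \sum_s a1 q s * b1 s q
    + \sum_q \sum_s a1 q s * b3 q s - \sum_q \sum_s a1 s q * b1 q s
    + \sum_q \sum_s a1 s q * b1 s q - \sum_q \sum_s a1 s q * b3 q s
    + \sum_q \sum_s a3 q s * b1 q s - \sum_q \sum_s a3 q s * b1 s q
    + \sum_q \sum_s a3 q s * b3 q s).
  rewrite -!sumrN -!big_split /=; apply: eq_bigr => q _.
  rewrite -!sumrN -!big_split /=; apply: eq_bigr => s _.
  by rewrite /tau -/(a1 q s) -/(a1 s q) -/(a3 q s) -/(b1 q s) -/(b1 s q) -/(b3 q s); ring.
rewrite s11 s12 s13 s21 s22 s23 s31 s32 s33; ring.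
Qed.

Lemma nil_ricciE :
  nil_ricci br G z w =
  - 2%:R^-1 * (B1 + B2 + B3) + 4%:R^-1 * (C1 + 2%:R * C2).
Proof.
rewrite /nil_ricci (trace_split (f := fun u v => g [z, u] [w, v])); try by_linearity.
congr (_ * _ + _ * _).
  rewrite -/B1 -addrA; congr (_ + _); rewrite /B2 /B3 -big_split; apply: eq_bigr => s _.
  by rewrite /= -bformDl proj_sum.
have inner i : \sum_j g [ev i, ev j] z * g [dual_ev G i, dual_ev G j] w
  = \sum_t g [ev i, Z t] z * g [dual_ev G i, Zd t] w
  + \sum_t g [ev i, Zd t] z * g [dual_ev G i, Z t] w.
  by rewrite (trace_split (f := fun u v => g [ev i, u] z * g [dual_ev G i, v] w));
    try by_linearity.
under eq_bigr do rewrite inner.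
rewrite big_split /= exchange_big [X in _ + X]exchange_big /=.
have outer a b : \sum_i g [ev i, a] z * g [dual_ev G i, b] w
  = \sum_s g [Z s, a] z * g [Zd s, b] w + \sum_s g [Zd s, a] z * g [Z s, b] w.
  by rewrite (trace_split (f := fun u v => g [u, a] z * g [v, b] w)); try by_linearity.
under eq_bigr do rewrite outer.
under [X in _ + X]eq_bigr do rewrite outer.
rewrite !big_split /=.
(* A bracket of two (1,0) vectors is again (1,0), hence orthogonal to [z]. *)
have -> : \sum_t \sum_s g [Z s, Z t] z * g [Zd s, Zd t] w = 0.
  apply: big1 => t _; apply: big1 => s _.
  by rewrite (eig_orth ii (br_eig ii (Z10 s) (Z10 t)) z10) mul0r.
rewrite add0r exchange_big /=.
have -> : \sum_s \sum_t g [Zd s, Z t] z * g [Z s, Zd t] w = C2.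
  rewrite exchange_big; apply: eq_bigr => s _; apply: eq_bigr => t _.
  by rewrite [[Zd t, Z s]]brC [[Z t, Zd s]]brC !bformNl mulrNN.
rewrite exchange_big [X in _ + (_ + X)]exchange_big /= -/C2 -/C1; ring.
Qed.

(** The coefficients of [B1], [B2], [B3] all become -1/2 (for [B2] as -1 + 1/2), that of [C1] is
    1/4, and that of [C2] is 1 - 1/2. *)
Lemma chern_ricci_identity :
  \sum_s g (curv D br (Z s) (Zd s) z) w
  - 2%:R^-1 * (\sum_q \sum_s tau z (Z s) (Zd q) * tau w (Zd s) (Z q))
  + 4%:R^-1 * (\sum_q \sum_s tau (Z s) (Z q) w * tau (Zd s) (Zd q) z)
  = nil_ricci br G z w.
Proof.
rewrite chern_ricci2E torsion_sq1E torsion_sq2E nil_ricciE.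
by field; rewrite ?two_neq0 ?four_neq0.
Qed.
End Tensors.

(** * The vector H and the torsion traces *)

Definition bracket_trace : 'rV[F]_m := \sum_s [Z s, Zd s].
Local Notation H := bracket_trace.

Lemma trace_ad_frame x : \sum_s g [x, Z s] (Zd s) + \sum_s g [x, Zd s] (Z s) = 0.
Proof.
rewrite -(trace_split (f := fun u v => g [x, u] v)); try by_linearity.
exact: trace_ad.
Qed.

(** The two terms of [tau] with [x] inside the bracket add up to minus the trace of [ad x], which is
    zero. *)
Lemma torsion_trace10 x : \sum_s tau x (Z s) (Zd s) = g x H.
Proof.
rewrite -[RHS]subr0 -[X in _ = _ - X](trace_ad_frame x) opprD addrA.
rewrite bform_sumr -!sumrN -!big_split.
by apply: eq_bigr => s _; rewrite /= /tau [g (Z s) _]gC; ring.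
Qed.

Lemma torsion_trace01 y : \sum_s tau y (Zd s) (Z s) = - g y H.
Proof.
rewrite -[RHS]subr0 -[X in _ = _ - X](trace_ad_frame y) opprD addrA.
rewrite bform_sumr -!sumrN -!big_split.
by apply: eq_bigr => s _; rewrite /= /tau [g (Zd s) _]gC [[Zd s, Z s]]brC bformNr; ring.
Qed.

Lemma g_J_skew x y : g (x *m J) y = - g x (y *m J).
Proof. by rewrite -(gJ (x *m J)) mulJJ bformNl. Qed.

(** The sum pairs [H] with its (0,1) part; the factor 1/2 remains since [J H] is orthogonal to
    [H]. *)
Lemma bracket_trace_sq : \sum_s g (Z s) H * g (Zd s) H = 2%:R^-1 * g H H.
Proof.
rewrite (contract_Zd H (f := fun v => g v H)); last by_linearity.
rewrite mul_pb bformZl bformDl bformZl.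
have -> : g (H *m J) H = 0 by apply: (@eq_opp0 F^o); rewrite {1}g_J_skew gC.
by rewrite mulr0 addr0.
Qed.

Lemma lee_vectorE x : g (lee_vector br J G) x = 2%:R * I * g H x.
Proof.
have P k u v : (k *: u + v) *m J = k *: (u *m J) + v *m J.
  by rewrite mulmxDl scalemxAl.
rewrite bform_suml (trace_split (f := fun u v => g [u *m J, v] x));
  try by intros; rewrite ?P; by_linearity.
rewrite bform_suml mulr_sumr -big_split; apply: eq_bigr => s _ /=.
rewrite Z10 Zd01 !bilinZl [[Zd s, Z s]]brC scalerN scaleNr opprK !bformZl; ring.
Qed.

(** For a real metric the left side is a squared norm, which fixes the sign of the complex bilinear
    square [g H H]. *)
Lemma lee_vector_sq :
  g (lee_vector br J G) (lee_vector br J G) = - (4%:R * g H H).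
Proof.
rewrite lee_vectorE gC lee_vectorE.
transitivity (4%:R * (I * I) * g H H); first ring.
rewrite ii; ring.
Qed.

(* This is [Q^3 / 2 - Q^4]: each of their terms carries a torsion trace. *)
Definition lee_part z w : F :=
  - 2%:R^-1 * (g z H * g w H)
  - 2%:R^-1 * \sum_q (g (Z q) H * tau (Zd q) w z - tau (Z q) z w * g (Zd q) H).

(** The first term of [lee_part] contributes -1/4; in the second, the remaining torsion traces are
    again pairings with [H] and contribute 1/2. *)
Lemma lee_part_trace : \sum_s lee_part (Z s) (Zd s) = 4%:R^-1 * g H H.
Proof.
rewrite /lee_part big_split /= -!mulr_sumr bracket_trace_sq sumrN -mulr_sumr exchange_big /=.
have -> : \sum_q \sum_s (g (Z q) H * tau (Zd q) (Zd s) (Z s)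
                           - tau (Z q) (Z s) (Zd s) * g (Zd q) H)
  = - (2%:R * \sum_q g (Z q) H * g (Zd q) H).
  rewrite mulr_sumr -sumrN; apply: eq_bigr => q _.
  rewrite big_split /= sumrN -mulr_sumr -mulr_suml torsion_trace10 torsion_trace01; ring.
rewrite bracket_trace_sq.
have : 4%:R != 0 :> F by exact: four_neq0.
by move=> f0; field; rewrite ?two_neq0 ?f0.
Qed.

Lemma nil_ricci_trace :
  2%:R * (\sum_s nil_ricci br G (Z s) (Zd s)) = \sum_i nil_ricci br G (ev i) (dual_ev G i).
Proof.
rewrite (trace_split (nil_ricciPl br G) (nil_ricciPr br G)).
under [X in _ + X]eq_bigr do rewrite nil_ricciC //.
ring.
Qed.

Lemma tauP1 k a b x y : tau (k *: a + b) x y = k * tau a x y + tau b x y.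
Proof. by rewrite /tau; by_linearity. Qed.
Lemma tauP2 k a b x y : tau x (k *: a + b) y = k * tau x a y + tau x b y.
Proof. by rewrite /tau; by_linearity. Qed.
Lemma tauP3 k a b x y : tau x y (k *: a + b) = k * tau x y a + tau x y b.
Proof. by rewrite /tau; by_linearity. Qed.

Lemma lee_partPr z k a b : lee_part z (k *: a + b) = k * lee_part z a + lee_part z b.
Proof.
rewrite /lee_part bformPl.
under eq_bigr => q _.
  rewrite tauP2 tauP3.
  have -> : g (Z q) H * (k * tau (Zd q) a z + tau (Zd q) b z)
      - (k * tau (Z q) z a + tau (Z q) z b) * g (Zd q) H =
    k * (g (Z q) H * tau (Zd q) a z - tau (Z q) z a * g (Zd q) H)
    + (g (Z q) H * tau (Zd q) b z - tau (Z q) z b * g (Zd q) H) by ring.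
  over.
by rewrite big_split -mulr_sumr /=; ring.
Qed.

(** * The tensor K and its trace *)

Section HermitianCurvatureFlow.
Variables (h : 'M[F]_n) (Zb : 'I_n -> 'rV[F]_m).
Hypothesis ZdE : Zd = dual_frame h Zb.

Ltac by_tau := by intros; cbv beta; rewrite ?(tauP1, tauP2, tauP3); ring.

(** The left side is K with torsion written as [tau]. Passing to the dual frame leaves
    [chern_ricci_identity] for S, Q^1, Q^2, and torsion traces for Q^3, Q^4. *)
Lemma hcf_tensorE z w : eig I z -> eig (- I) w ->
  \sum_r \sum_s h r s * g (curv D br (Z s) (Zb r) z) w
  - (2%:R^-1 * (\sum_p \sum_q \sum_r \sum_s
        h p q * h r s * tau z (Z s) (Zb p) * tau w (Zb r) (Z q))
     - 4%:R^-1 * (\sum_p \sum_q \sum_r \sum_s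
        h p q * h r s * tau (Z s) (Z q) w * tau (Zb r) (Zb p) z)
     - 2%:R^-1 * (\sum_p \sum_q \sum_r \sum_s
        h p q * h r s * tau z (Z s) (Zb r) * tau w (Zb p) (Z q))
     + 2%:R^-1 * (\sum_p \sum_q \sum_r \sum_s
        h p q * h r s * (tau (Z q) (Z s) (Zb r) * tau (Zb p) w z
                         + tau (Z q) z w * tau (Zb p) (Zb r) (Z s))))
  = nil_ricci br G z w + lee_part z w.
Proof.
move=> z10 w01; rewrite -(chern_ricci_identity z10 w01).
have assoc (A B : 'I_n -> 'I_n -> 'I_n -> 'I_n -> F) :
  \sum_p \sum_q \sum_r \sum_s h p q * h r s * A p q r s * B p q r s
  = \sum_p \sum_q \sum_r \sum_s h p q * h r s * (A p q r s * B p q r s).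
  do 4! [apply: eq_bigr => ? _]; by rewrite mulrA.
rewrite !assoc.
rewrite (contract_frame _ _ _ (f := fun a b => g (curv D br a b z) w)); last first.
  by move=> k x y a; rewrite curvPm bformPl.
rewrite (contract_frame2 _ _ _ (f := fun u v u' v' => tau z u' v * tau w v' u)); try by_tau.
rewrite (contract_frame2 _ _ _ (f := fun u v u' v' => tau u' u w * tau v' v z)); try by_tau.
rewrite (contract_frame2 _ _ _ (f := fun u v u' v' => tau z u' v' * tau w v u)); try by_tau.
rewrite (contract_frame2 _ _ _ (f := fun u v u' v' =>
  tau u u' v' * tau v w z + tau u z w * tau v v' u')); try by_tau.
rewrite -ZdE.
have -> : \sum_q \sum_s tau z (Z s) (Zd s) * tau w (Zd q) (Z q) = - (g z H * g w H).
  under eq_bigr do rewrite -mulr_suml torsion_trace10.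
  by rewrite -mulr_sumr torsion_trace01 mulrN.
have -> : \sum_q \sum_s (tau (Z q) (Z s) (Zd s) * tau (Zd q) w z
    + tau (Z q) z w * tau (Zd q) (Zd s) (Z s))
  = \sum_q (g (Z q) H * tau (Zd q) w z - tau (Z q) z w * g (Zd q) H).
  apply: eq_bigr => q _.
  by rewrite big_split /= -mulr_suml -mulr_sumr torsion_trace10 torsion_trace01 mulrN.
rewrite /lee_part; ring.
Qed.

(** The constant -1/8 is [2 * 1/4 * (-1/4)]: the normalisation of the trace, [lee_part_trace], and
    [lee_vector_sq]. *)
Lemma hcf_traceE :
  2%:R * (\sum_j \sum_k h k j * (nil_ricci br G (Z j) (Zb k) + lee_part (Z j) (Zb k)))
  = \sum_i nil_ricci br G (ev i) (dual_ev G i)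
    - 8%:R^-1 * g (lee_vector br J G) (lee_vector br J G).
Proof.
rewrite exchange_big /=.
rewrite (contract_frame _ _ _ (f := fun a b => nil_ricci br G a b + lee_part a b)); last first.
  by intros; rewrite nil_ricciPr lee_partPr; ring.
rewrite -ZdE big_split mulrDr nil_ricci_trace lee_part_trace lee_vector_sq; congr (_ + _).
have e4 : 4%:R = 2%:R * 2%:R :> F by rewrite -natrM.
have e8 : 8%:R = 2%:R * 2%:R * 2%:R :> F by rewrite -!natrM.
(* With every numeral a power of an abstract nonzero [t], [field] has only [t != 0] to check. *)
rewrite e8 e4; move: two_neq0; move: (2%:R : F) => t t0.
by field; rewrite t0.
Qed.
End HermitianCurvatureFlow.
End ComplexFrame.

(** * Dual frames and complexification *)

Section Resolution.
Variables (F : fieldType) (m n : nat) (I : F) (J G : 'M[F]_m) (Z Zb : 'I_n -> 'rV[F]_m).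
Local Notation g := (bform G).
Let gm := \matrix_(j < n, k < n) g (Z j) (Zb k).
Local Notation Zd := (dual_frame (invmx gm) Zb).
Hypotheses (two_neq0 : 2%:R != 0 :> F) (ii : I * I = -1) (Gsym : G^T = G)
  (gJ : forall x y, g (x *m J) (y *m J) = g x y).
Hypotheses (Z10 : forall s, eig J I (Z s)) (Zb01 : forall s, eig J (- I) (Zb s)).
Hypothesis gm_unit : gm \in unitmx.
Hypothesis span : forall u, exists a b : 'rV[F]_n,
  u = \sum_t a 0 t *: Z t + \sum_t b 0 t *: Zb t.

Let NN : - I * - I = -1. Proof. by rewrite mulrNN. Qed.

Lemma dual_frame_eig s : eig J (- I) (Zd s).
Proof.
rewrite /eig /dual_frame mulmx_suml scaler_sumr; apply: eq_bigr => r _.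
by rewrite -scalemxAl Zb01 !scalerA mulrC.
Qed.

Lemma frame_ext (W : lmodType F) (f1 f2 : 'rV[F]_m -> W) :
  (forall k x y, f1 (k *: x + y) = k *: f1 x + f1 y) ->
  (forall k x y, f2 (k *: x + y) = k *: f2 x + f2 y) ->
  (forall t, f1 (Z t) = f2 (Z t)) -> (forall t, f1 (Zb t) = f2 (Zb t)) ->
  forall u, f1 u = f2 u.
Proof.
move=> P1 P2 EZ EZb u; have [a [b ->]] := span u.
rewrite (linD P1) (linD P2) !(lin_sum P1) !(lin_sum P2).
by congr (_ + _); apply: eq_bigr => t _; rewrite (linZ P1) (linZ P2) ?EZ ?EZb.
Qed.

Lemma eig_proj10 u : eig J I u -> u *m proj10 I J = u.
Proof.
move=> eu; rewrite mul_p eu scalerA ii scaleN1r opprK -mulr2n -[u *+ 2]scaler_nat.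
by rewrite scalerA mulVf ?scale1r.
Qed.
Lemma eig_proj10_eq0 u : eig J (- I) u -> u *m proj10 I J = 0.
Proof. by move=> eu; rewrite mul_p eu scalerA mulrN ii opprK scale1r subrr scaler0. Qed.
Lemma eig_proj01 u : eig J (- I) u -> u *m proj01 I J = u.
Proof.
move=> eu; rewrite mul_pb eu scalerA mulrN ii opprK scale1r -mulr2n -[u *+ 2]scaler_nat.
by rewrite scalerA mulVf ?scale1r.
Qed.
Lemma eig_proj01_eq0 u : eig J I u -> u *m proj01 I J = 0.
Proof. by move=> eu; rewrite mul_pb eu scalerA ii scaleN1r subrr scaler0. Qed.

(** Both sides are linear in [u]: on [Z t] the claim is duality of [Zd] and [Z], and on [Zb t] both
    sides vanish by type. *)
Lemma resolution10 u : \sum_s g u (Zd s) *: Z s = u *m proj10 I J.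
Proof.
apply: (frame_ext (f1 := fun u => \sum_s g u (Zd s) *: Z s)
  (f2 := mulmx^~ (proj10 I J))) => [k x y|k x y|t|t].
- rewrite scaler_sumr -big_split; apply: eq_bigr => s _ /=.
  by rewrite bformPl scalerDl scalerA.
- by rewrite mulmxDl scalemxAl.
- rewrite eig_proj10 //.
  have E s : g (Z t) (Zd s) = (t == s)%:R.
    have := congr1 (fun M : 'M_n => M t s) (mulmxV gm_unit); rewrite !mxE => <-.
    rewrite bform_sumr; apply: eq_bigr => r _.
    by rewrite bformZr mxE mulrC.
  rewrite (bigD1 t) //= E eqxx scale1r big1 ?addr0 // => s st.
  by rewrite E eq_sym (negPf st) scale0r.
- rewrite eig_proj10_eq0 // big1 // => s _.
  by rewrite (eig_orth two_neq0 gJ NN (Zb01 t) (dual_frame_eig s)) scale0r.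
Qed.

Lemma resolution01 u : \sum_s g (Z s) u *: Zd s = u *m proj01 I J.
Proof.
apply: (frame_ext (f1 := fun u => \sum_s g (Z s) u *: Zd s)
  (f2 := mulmx^~ (proj01 I J))) => [k x y|k x y|t|t].
- rewrite scaler_sumr -big_split; apply: eq_bigr => s _ /=.
  by rewrite bformPr scalerDl scalerA.
- by rewrite mulmxDl scalemxAl.
- rewrite eig_proj01_eq0 // big1 // => s _.
  by rewrite (eig_orth two_neq0 gJ ii (Z10 s) (Z10 t)) scale0r.
- rewrite eig_proj01 // /dual_frame.
  under eq_bigr => s _ do rewrite scaler_sumr.
  rewrite exchange_big /=.
  have E r : \sum_s invmx gm r s * g (Z s) (Zb t) = (r == t)%:R.
    have := congr1 (fun M : 'M_n => M r t) (mulVmx gm_unit); rewrite !mxE => <-.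
    by apply: eq_bigr => s _; rewrite [gm s t]mxE.
  have E' r : \sum_s g (Z s) (Zb t) *: (invmx gm r s *: Zb r) = (r == t)%:R *: Zb r.
    by rewrite -E scaler_suml; apply: eq_bigr => s _; rewrite scalerA mulrC.
  rewrite (bigD1 t) //= E' eqxx scale1r big1 ?addr0 // => s /negPf st.
  by rewrite E' st scale0r.
Qed.
End Resolution.

(** * Passage from real to complex vectors *)

Section Complexify.
Variables (R : rcfType) (n : nat).
Local Notation m := n.*2.
Local Notation C := R[i].
Implicit Types (c : 'I_m -> 'I_m -> 'rV[R]_m) (B : 'M[R]_m) (x y : 'rV[R]_m)
  (u v : 'rV[C]_m).

Lemma cvec_split u : u = 'i *: cmx (map_mx (@complex.Im R) u) + cmx (map_mx (@complex.Re R) u).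
Proof. by apply/rowP => i; rewrite !mxE addrC -complexE. Qed.

(** Extends a multilinear identity from real to complex vectors, one argument at a time. *)
Lemma cvec_ind (P : 'rV[C]_m -> Prop) :
  (forall x, P (cmx x)) -> (forall k u v, P u -> P v -> P (k *: u + v)) ->
  forall u, P u.
Proof. by move=> P0 P1 u; rewrite (cvec_split u); apply: P1. Qed.

Lemma bilin_cmx c x y : bilin (cconst c) (cmx x) (cmx y) = cmx (bilin c x y).
Proof.
rewrite /cmx [RHS](map_mx_sum (real_complex R)); apply: eq_bigr => i _.
rewrite (map_mx_sum (real_complex R)); apply: eq_bigr => j _.
by rewrite [RHS](map_mxZ (real_complex R)) rmorphM !mxE.
Qed.

Lemma bform_cmx B x y : bform (cmx B) (cmx x) (cmx y) = (bform B x y)%:C.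
Proof.
rewrite [RHS](rmorph_sum (real_complex R)); apply: eq_bigr => i _.
rewrite (rmorph_sum (real_complex R)); apply: eq_bigr => j _.
by rewrite !rmorphM !mxE.
Qed.

Lemma cmx_mul (p q r : nat) (A : 'M[R]_(p, q)) (B : 'M[R]_(q, r)) :
  cmx (A *m B) = cmx A *m cmx B.
Proof. exact: (map_mxM (real_complex R)). Qed.

Lemma cmx_ev i : cmx (ev i) = ev i :> 'rV[C]_m.
Proof. exact: (map_delta_mx (real_complex R)). Qed.

Lemma cmx_dual_ev B i : cmx (dual_ev B i) = dual_ev (cmx B) i.
Proof.
rewrite !dual_evE /cmx; have := map_invmx (real_complex R) B => <-.
by rewrite map_row.
Qed.

Lemma conjv_bilin c u v :
  conjv (bilin (cconst c) u v) = bilin (cconst c) (conjv u) (conjv v).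
Proof.
rewrite /conjv [LHS](map_mx_sum (@conjc R)); apply: eq_bigr => i _.
rewrite [LHS](map_mx_sum (@conjc R)); apply: eq_bigr => j _.
rewrite [LHS](map_mxZ (@conjc R)) rmorphM !mxE; congr (_ *: _).
by apply/rowP => k; rewrite !mxE /= oppr0.
Qed.

Lemma conjc_bform B u v :
  (bform (cmx B) u v)^* = bform (cmx B) (conjv u) (conjv v).
Proof.
rewrite [LHS](rmorph_sum (@conjc R)); apply: eq_bigr => i _.
rewrite [LHS](rmorph_sum (@conjc R)); apply: eq_bigr => j _.
by rewrite !rmorphM !mxE /= oppr0.
Qed.

Lemma nil_ricci_cmx c B x y :
  nil_ricci (cconst c) (cmx B) (cmx x) (cmx y) = (nil_ricci c B x y)%:C.
Proof.
rewrite /nil_ricci rmorphD !rmorphM rmorphN !fmorphV !rmorph_nat !rmorph_sum.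
congr (_ * _ + _ * _).
  by apply: eq_bigr => i _; rewrite -cmx_ev -cmx_dual_ev !bilin_cmx bform_cmx.
apply: eq_bigr => i _; rewrite rmorph_sum; apply: eq_bigr => j _.
by rewrite -!cmx_ev -!cmx_dual_ev !bilin_cmx !bform_cmx rmorphM.
Qed.
End Complexify.

(** * Left-invariant Hermitian metrics *)

Lemma posdef_unitmx (R : rcfType) (m : nat) (G : 'M[R]_m) :
  (forall x, x != 0 -> 0 < bform G x x) -> G \in unitmx.
Proof.
move=> pos; rewrite -row_free_unit; apply: inj_row_free => v vG.
apply/eqP/negPn/negP => /pos; rewrite bformE vG mul0mx mxE.
by rewrite ltxx.
Qed.

Section HermitianLieAlgebra.
Variables (R : rcfType) (n : nat).
Local Notation m := n.*2.
Local Notation C := R[i].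
Variables (br L D : 'I_m -> 'I_m -> 'rV[R]_m) (Jm Gm : 'M[R]_m) (Z : 'I_n -> 'rV[C]_m).
Hypotheses (nil : two_step_nilpotent br) (cs : complex_structure br Jm)
  (Jc : J_mu_central br Jm) (hm : hermitian_metric Jm Gm)
  (LC : levi_civita br Gm L) (CC : chern_connection br Jm Gm D) (hf : hol_frame Jm Z).

Local Notation brc := (cconst br).
Local Notation Dc := (cconst D).
Local Notation J := (cmx Jm).
Local Notation G := (cmx Gm).
Local Notation g := (bform G).
Local Notation Zb := (fun r => conjv (Z r)).
Local Notation Zd := (dual_frame (ginv Gm Z) Zb).

Let two_neq0 : 2%:R != 0 :> C. Proof. by rewrite pnatr_eq0. Qed.
Let ii : 'i * 'i = -1 :> C. Proof. by rewrite -expr2 sqr_i. Qed.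
Let Gsym : Gm^T = Gm. Proof. by case: hm. Qed.
Let Gpos x : x != 0 -> 0 < bform Gm x x. Proof. by case: hm => _ [pos _]; exact: pos. Qed.
Let Gunit : Gm \in unitmx. Proof. exact: posdef_unitmx. Qed.
Let br_alt x : bilin br x x = 0. Proof. by case: nil => [[alt _] _]. Qed.
Let br_nil x y z : bilin br (bilin br x y) z = 0. Proof. by case: nil => [_ []]. Qed.
Let JJ : Jm *m Jm = - 1%:M. Proof. by case: cs. Qed.
Let gJr x y : bform Gm (x *m Jm) (y *m Jm) = bform Gm x y. Proof. by case: hm => _ [_]. Qed.

Lemma cGsym : G^T = G.
Proof. by apply/matrixP => i j; rewrite !mxE -{1}Gsym mxE. Qed.

Lemma cGunit : G \in unitmx.
Proof. by rewrite [_ \in _](map_unitmx (real_complex R)). Qed.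

Lemma cJJ : J *m J = - 1%:M.
Proof.
rewrite -cmx_mul JJ /cmx [LHS](map_mxN (real_complex R)).
by rewrite [map_mx _ _](map_mx1 (real_complex R)).
Qed.

Lemma cgJ x y : g (x *m J) (y *m J) = g x y.
Proof.
elim/cvec_ind: x => [x|k u v Hu Hv]; last first.
  by rewrite mulmxDl -scalemxAl !bformPl Hu Hv.
elim/cvec_ind: y => [y|k u v Hu Hv]; last first.
  by rewrite mulmxDl -scalemxAl !bformPr Hu Hv.
by rewrite -!cmx_mul !bform_cmx gJr.
Qed.

Lemma cbr_alt x : bilin brc x x = 0.
Proof.
have brC := bilinC br_alt.
rewrite (cvec_split x) !(bilinDl, bilinDr, bilinZl, bilinZr) !bilin_cmx !br_alt.
rewrite (brC (map_mx _ x) (map_mx (@complex.Re R) x)) /cmx (map_mx0 (real_complex R)).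
by rewrite (map_mxN (real_complex R)) !scaler0 addr0 add0r scalerN subrr.
Qed.

Lemma cbr_nil x y z : bilin brc (bilin brc x y) z = 0.
Proof.
elim/cvec_ind: x => [x|k u v Hu Hv]; last by rewrite !bilinPl Hu Hv scaler0 addr0.
elim/cvec_ind: y => [y|k u v Hu Hv]; last by rewrite bilinPr bilinPl Hu Hv scaler0 addr0.
elim/cvec_ind: z => [z|k u v Hu Hv]; last by rewrite bilinPr Hu Hv scaler0 addr0.
by rewrite !bilin_cmx br_nil /cmx (map_mx0 (real_complex R)).
Qed.

Lemma cbr_nilJ x y z : bilin brc (bilin brc x y *m J) z = 0.
Proof.
have P (k : C) u v : (k *: u + v) *m J = k *: (u *m J) + v *m J.
  by rewrite mulmxDl scalemxAl.
elim/cvec_ind: x => [x|k u v Hu Hv]; last by rewrite bilinPl P bilinPl Hu Hv scaler0 addr0.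
elim/cvec_ind: y => [y|k u v Hu Hv]; last by rewrite bilinPr P bilinPl Hu Hv scaler0 addr0.
elim/cvec_ind: z => [z|k u v Hu Hv]; last by rewrite bilinPr Hu Hv scaler0 addr0.
by rewrite bilin_cmx -cmx_mul bilin_cmx Jc /cmx (map_mx0 (real_complex R)).
Qed.

Lemma cmxD (x y : 'rV[R]_m) : cmx (x + y) = cmx x + cmx y.
Proof. exact: (map_mxD (real_complex R)). Qed.
Lemma cmxN (x : 'rV[R]_m) : cmx (- x) = - cmx x.
Proof. exact: (map_mxN (real_complex R)). Qed.
Lemma cmx0 : cmx (0 : 'rV[R]_m) = 0.
Proof. exact: (map_mx0 (real_complex R)). Qed.

Lemma cbr_int x y : bilin brc (x *m J) (y *m J) - bilin brc (x *m J) y *m J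
  - bilin brc x (y *m J) *m J - bilin brc x y = 0.
Proof.
rewrite -/(nijenhuis brc J x y).
elim/cvec_ind: x => [x|k u v Hu Hv]; last by rewrite nijenhuisPl Hu Hv scaler0 addr0.
elim/cvec_ind: y => [y|k u v Hu Hv]; last by rewrite nijenhuisPr Hu Hv scaler0 addr0.
rewrite /nijenhuis -!cmx_mul !bilin_cmx -!cmx_mul -!cmxN -!cmxD.
by case: cs => _ ->; rewrite cmx0.
Qed.

Lemma cDmet x y z : g (bilin Dc x y) z + g y (bilin Dc x z) = 0.
Proof.
have [met _] := CC.
elim/cvec_ind: x => [x|k u v Hu Hv]; last first.
  by rewrite !bilinPl bformPl bformPr addrACA -mulrDr Hu Hv mulr0 addr0.
elim/cvec_ind: y => [y|k u v Hu Hv]; last first.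
  by rewrite !bilinPr !bformPl addrACA -mulrDr Hu Hv mulr0 addr0.
elim/cvec_ind: z => [z|k u v Hu Hv]; last first.
  by rewrite !bilinPr !bformPr addrACA -mulrDr Hu Hv mulr0 addr0.
by rewrite !bilin_cmx !bform_cmx -rmorphD met rmorph0.
Qed.

Lemma cDJ x y : bilin Dc x (y *m J) = bilin Dc x y *m J.
Proof.
have [_ [DJ _]] := CC.
elim/cvec_ind: x => [x|k u v Hu Hv]; last first.
  by rewrite !bilinPl mulmxDl -scalemxAl Hu Hv.
elim/cvec_ind: y => [y|k u v Hu Hv]; last first.
  by rewrite bilinPr !mulmxDl -!scalemxAl bilinPr Hu Hv.
by rewrite -cmx_mul !bilin_cmx DJ cmx_mul.
Qed.

Lemma cDtor x y : torsion Dc brc (x *m J) (y *m J) = - torsion Dc brc x y.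
Proof.
have [_ [_ tor]] := CC.
elim/cvec_ind: x => [x|k u v Hu Hv]; last first.
  by rewrite mulmxDl -scalemxAl !torsionPl Hu Hv [RHS]opprD scalerN.
elim/cvec_ind: y => [y|k u v Hu Hv]; last first.
  by rewrite mulmxDl -scalemxAl !torsionPr Hu Hv [RHS]opprD scalerN.
by rewrite -!cmx_mul /torsion !bilin_cmx -!cmxN -!cmxD -!cmxN; congr cmx; exact: tor.
Qed.

Lemma hol_frame_eig s : eig J 'i (Z s).
Proof. by case: hf => + _; apply. Qed.

Lemma conjv_mul x : conjv (x *m J) = conjv x *m J.
Proof.
rewrite /conjv [LHS](map_mxM (@conjc R)); congr (_ *m _).
by apply/matrixP => i j; rewrite !mxE /= oppr0.
Qed.

Lemma conj_frame_eig s : eig J (- 'i) (conjv (Z s)).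
Proof.
rewrite /eig -conjv_mul (hol_frame_eig s) /conjv [LHS](map_mxZ (@conjc R)).
by congr (_ *: _); apply/eqP; rewrite eq_complex /= oppr0 !eqxx.
Qed.

(** For [u = a + i b] with real [a], [b], the pairing equals [g a a + g b b]. *)
Lemma g_conj_eq0 u : g u (conjv u) = 0 -> u = 0.
Proof.
pose a := map_mx (@complex.Re R) u; pose b := map_mx (@complex.Im R) u.
have Eu : u = 'i *: cmx b + cmx a by exact: cvec_split.
have Ec : conjv u = (- 'i) *: cmx b + cmx a.
  apply/rowP => i; rewrite !mxE.
  by case: (u 0 i) => p q; rewrite /= ; simpc.
rewrite Ec {1}Eu bformPl !bformPr !bform_cmx (bformC Gsym a b) => E.
have : (bform Gm a a + bform Gm b b)%:C = 0 :> C.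
  rewrite -[RHS]E rmorphD.
  transitivity ((- ('i * 'i)) * (bform Gm b b)%:C + (bform Gm a a)%:C); last ring.
  by rewrite ii; ring.
move/eqP; rewrite (fmorph_eq0 (real_complex R)) => /eqP {}E.
have ge x : 0 <= bform Gm x x.
  by have [->|/Gpos/ltW//] := eqVneq x 0; rewrite bform0l.
have eq0 x : bform Gm x x = 0 -> x = 0.
  by move=> x0; apply/eqP/negPn/negP => /Gpos; rewrite x0 ltxx.
move/eqP: E; rewrite paddr_eq0 // => /andP[/eqP/eq0 a0 /eqP/eq0 b0].
by rewrite Eu a0 b0 cmx0 scaler0 addr0.
Qed.

Local Notation Zm := (\matrix_(j < n, k < m) Z j 0 k).

Lemma row_Zm j : row j Zm = Z j.
Proof. by apply/rowP => k; rewrite !mxE. Qed.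

Lemma mul_Zm (a : 'rV[C]_n) : a *m Zm = \sum_t a 0 t *: Z t.
Proof. by rewrite mulmx_sum_row; apply: eq_bigr => t _; rewrite row_Zm. Qed.

Lemma mul_Zbm (a : 'rV[C]_n) : a *m map_mx (@conjc R) Zm = \sum_t a 0 t *: conjv (Z t).
Proof.
rewrite mulmx_sum_row; apply: eq_bigr => t _; congr (_ *: _).
by rewrite -map_row row_Zm.
Qed.

(** A kernel row yields a combination of the [Z t] orthogonal to every [conjv (Z t)], hence to its
    own conjugate. *)
Lemma gmat_unit : gmat Gm Z \in unitmx.
Proof.
have [_ Zfree] := hf.
rewrite -row_free_unit; apply: inj_row_free => v vG.
apply: (row_free_inj Zfree); rewrite mul0mx; apply: g_conj_eq0.
have -> : conjv (v *m Zm) = map_mx (@conjc R) v *m map_mx (@conjc R) Zm.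
  exact: (map_mxM (@conjc R)).
rewrite mul_Zbm mul_Zm bform_sumr big1 // => t _.
rewrite bformZr bform_suml.
have := congr1 (fun M : 'rV_n => M 0 t) vG; rewrite !mxE => E.
rewrite (_ : \sum_i _ = 0) ?mulr0 // -[RHS]E.
by apply: eq_bigr => j _; rewrite bformZl mxE.
Qed.

(** The two families lie in different eigenspaces of [J], so together they are [n + n] independent
    vectors in dimension [n.*2]. *)
Lemma frame_span u : exists a b : 'rV[C]_n,
  u = \sum_t a 0 t *: Z t + \sum_t b 0 t *: conjv (Z t).
Proof.
have [ZJ Zfree] := hf.
have Zbfree : row_free (map_mx (@conjc R) Zm) by rewrite (row_free_map (@conjc R)).
have free : row_free (col_mx Zm (map_mx (@conjc R) Zm)).
  apply: inj_row_free => v; rewrite -(hsubmxK v) mul_row_col.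
  set a := lsubmx v; set b := rsubmx v => E.
  have aJ : a *m Zm *m J = 'i *: (a *m Zm).
    rewrite mul_Zm mulmx_suml scaler_sumr; apply: eq_bigr => t _.
    by rewrite -scalemxAl ZJ !scalerA mulrC.
  have bJ : b *m map_mx (@conjc R) Zm *m J = - 'i *: (b *m map_mx (@conjc R) Zm).
    rewrite mul_Zbm mulmx_suml scaler_sumr; apply: eq_bigr => t _.
    by rewrite -scalemxAl (conj_frame_eig t) !scalerA mulrC.
  have a0 : a *m Zm = 0.
    (* The operator [i J] is -1 on type (1,0) and +1 on type (0,1), which separates the relation. *)
    have := congr1 (fun M => 'i *: (M *m J)) E; rewrite mulmxDl aJ bJ mul0mx scaler0.
    rewrite scalerDr !scalerA mulrN ii opprK scaleN1r scale1r => E'.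
    apply: (eq_opp0 two_neq0); rewrite -[LHS]addr0 -[X in _ + X]E'.
    rewrite addrA subrr add0r.
    by apply/eqP; rewrite -addr_eq0 addrC E.
  have b0 : b *m map_mx (@conjc R) Zm = 0 by rewrite a0 add0r in E.
  have -> : a = 0 by apply: (row_free_inj Zfree); rewrite mul0mx.
  have -> : b = 0 by apply: (row_free_inj Zbfree); rewrite mul0mx.
  by rewrite row_mx0.
have full : row_full (col_mx Zm (map_mx (@conjc R) Zm)).
  by move/eqP: free => free; rewrite /row_full free addnn.
have /submxP[w ->] : (u <= col_mx Zm (map_mx (@conjc R) Zm))%MS by exact: submx_full.
exists (lsubmx w), (rsubmx w).
by rewrite -{1}(hsubmxK w) mul_row_col mul_Zm mul_Zbm.
Qed.

Lemma resZ u : \sum_s g u (Zd s) *: Z s = u *m proj10 'i J.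
Proof.
exact: (resolution10 two_neq0 ii cgJ hol_frame_eig conj_frame_eig gmat_unit frame_span).
Qed.

Lemma resZd u : \sum_s g (Z s) u *: Zd s = u *m proj01 'i J.
Proof.
exact: (resolution01 two_neq0 ii cgJ hol_frame_eig conj_frame_eig gmat_unit frame_span).
Qed.

Lemma conj_dual_frame_eig s : eig J (- 'i) (Zd s).
Proof. exact: dual_frame_eig conj_frame_eig s. Qed.

Lemma Tt_tau j s p : Tt br Gm D Z j s p = tau brc G (Z j) (Z s) (conjv (Z p)).
Proof.
exact: (torsionE two_neq0 cgJ cDmet cDJ cDtor (opp_iNi ii)
  (hol_frame_eig j) (hol_frame_eig s) (conj_frame_eig p)).
Qed.

Lemma conjvK u : conjv (conjv u) = u :> 'rV[C]_m.
Proof. by apply/rowP => i; rewrite !mxE conjcK. Qed.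

Lemma Tb_tau j s p : Tb br Gm D Z j s p = tau brc G (conjv (Z j)) (conjv (Z s)) (Z p).
Proof.
rewrite /Tb Tt_tau /tau rmorphB rmorphD rmorphN /= !conjc_bform !conjv_bilin.
by rewrite conjvK.
Qed.

Lemma KtE j k : Kt br Gm D Z j k =
  nil_ricci brc G (Z j) (conjv (Z k)) + lee_part brc G Z Zd (Z j) (conjv (Z k)).
Proof.
rewrite -(hcf_tensorE two_neq0 ii cGsym cGunit cJJ cgJ cbr_alt cbr_nil cbr_nilJ cbr_int
  cDmet cDJ cDtor hol_frame_eig conj_dual_frame_eig resZ resZd (erefl Zd)
  (hol_frame_eig j) (conj_frame_eig k)).
rewrite /Kt /Qt /Q1 /Q2 /Q3 /Q4 /S2.
congr (_ - (_ * _ - _ * _ - _ * _ + _ * _)); do 4! [apply: eq_bigr => ? _];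
  by rewrite !Tt_tau !Tb_tau.
Qed.

Lemma scalE : (scal br Gm L)%:C = \sum_i nil_ricci brc G (ev i) (dual_ev G i).
Proof.
rewrite /scal rmorph_sum; apply: eq_bigr => i _.
rewrite -cmx_ev -cmx_dual_ev nil_ricci_cmx; congr (_%:C).
rewrite /dual_ev (lin_sum (W := R^o) (fun k x y => nil_ricciPr br Gm k x y _)).
apply: eq_bigr => j _; rewrite (linZ (W := R^o) (fun k x y => nil_ricciPr br Gm k x y _)).
by rewrite (ricciE Gsym Gunit br_alt br_nil LC).
Qed.

(** Since [i (- i) = 1], averaging over [J] does not change a bilinear form on a (1,0) and a (0,1)
    vector. *)
Lemma ricci11CE u v : eig J 'i u -> eig J (- 'i) v ->
  ricci11C br Jm L u v = nil_ricci brc G u v.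
Proof.
move=> u10 v01.
pose f a b := 2%:R^-1 * (nil_ricci brc G a b + nil_ricci brc G (a *m J) (b *m J)).
have fl k x y z : f (k *: x + y) z = k * f x z + f y z.
  by rewrite /f mulmxDl -scalemxAl !nil_ricciPl; ring.
have fr z k x y : f z (k *: x + y) = k * f z x + f z y.
  by rewrite /f mulmxDl -scalemxAl !nil_ricciPr; ring.
transitivity (f u v).
  rewrite (lin_ev (W := C^o) (f := f ^~ v) (fun k x y => fl k x y v)).
  apply: eq_bigr => i _; rewrite (lin_ev (W := C^o) (fr (ev i))).
  rewrite scaler_sumr; apply: eq_bigr => j _.
  rewrite /f -!cmx_ev -!cmx_mul !nil_ricci_cmx /ricci11.
  rewrite !(ricciE Gsym Gunit br_alt br_nil LC) rmorphM rmorphD fmorphV rmorph_nat.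
  rewrite /GRing.scale /=; ring.
rewrite /f u10 v01.
have Zl := linZ (W := C^o) (f := nil_ricci brc G ^~ _)
  (fun k x y => nil_ricciPl brc G k x y _).
have Zr := linZ (W := C^o) (fun k x y => nil_ricciPr brc G k x y _).
rewrite Zl Zr scalerA mulrN ii opprK scale1r -mulr2n -(mulr_natl (nil_ricci brc G u v)).
by rewrite mulKf.
Qed.

(** * The balanced condition and the trace of K *)

Local Notation lee := (lee_vector br Jm Gm).

Lemma lee_cmx : lee_vector brc J G = cmx lee.
Proof.
rewrite /lee_vector /cmx (map_mx_sum (real_complex R)); apply: eq_bigr => i _.
by rewrite -cmx_ev -cmx_dual_ev -cmx_mul bilin_cmx.
Qed.

Lemma trKE : trK br Gm D Z = (scal br Gm L - 8%:R^-1 * bform Gm lee lee)%:C.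
Proof.
rewrite rmorphB rmorphM fmorphV rmorph_nat /= -bform_cmx -lee_cmx scalE.
rewrite -(hcf_traceE two_neq0 ii cGsym cGunit cJJ cgJ cbr_alt cbr_nil
  hol_frame_eig conj_dual_frame_eig resZ resZd (erefl Zd)).
rewrite /trK; congr (_ * _); apply: eq_bigr => j _; apply: eq_bigr => k _.
by rewrite KtE.
Qed.

(** Evaluating the codifferential at [lee] itself gives half its squared norm. *)
Lemma balancedE : balanced Jm Gm L <-> lee = 0.
Proof.
have E := codiff_fformE Gsym Gunit br_alt br_nil LC JJ gJr.
split=> [bal|l0 x]; last by rewrite E l0 bform0l mulr0.
apply/eqP/negPn/negP => /Gpos.
have := bal lee; rewrite E => /eqP; rewrite mulf_eq0 invr_eq0 pnatr_eq0 /= => /eqP ->.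
by rewrite ltxx.
Qed.

Lemma lee_part0 u v : lee = 0 -> lee_part brc G Z Zd u v = 0.
Proof.
move=> l0.
(* Since [lee] is [2 i H], each coordinate of [H], read off with the dual basis, vanishes; [H]
   occurs in every term of [lee_part]. *)
have H0 : bracket_trace brc Z Zd = 0.
  apply/rowP => i; rewrite -(bform_dual_ev cGsym cGunit) [RHS]mxE.
  have := lee_vectorE two_neq0 cGsym cGunit cbr_alt hol_frame_eig
    conj_dual_frame_eig resZ resZd (dual_ev G i).
  rewrite lee_cmx l0 cmx0 bform0l => /esym/eqP; rewrite !mulf_eq0 (negPf two_neq0) /=.
  have i0 : 'i != 0 :> C by rewrite eq_complex /= oner_eq0 andbF.
  by rewrite (negPf i0) /= => /eqP.
rewrite /lee_part H0 !bform0r mulr0 big1 ?mulr0 ?subrr // => q _.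
by rewrite !bform0r mul0r mulr0 subrr.
Qed.

End HermitianLieAlgebra.

Theorem theorem5p2 (R : rcfType) (n : nat)
    (br : 'I_(n.*2) -> 'I_(n.*2) -> 'rV[R]_(n.*2))
    (Jm Gm : 'M[R]_(n.*2))
    (L D : 'I_(n.*2) -> 'I_(n.*2) -> 'rV[R]_(n.*2))
    (Z : 'I_n -> 'rV[R[i]]_(n.*2)) :
  two_step_nilpotent br ->
  complex_structure br Jm ->
  J_mu_central br Jm ->
  hermitian_metric Jm Gm ->
  levi_civita br Gm L ->
  chern_connection br Jm Gm D ->
  hol_frame Jm Z ->
  (balanced Jm Gm L <-> trK br Gm D Z = (scal br Gm L)%:C) /\
  (balanced Jm Gm L ->
     forall j k : 'I_n, Kt br Gm D Z j k = ricci11C br Jm L (Z j) (conjv (Z k))).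
Proof.
move=> nil cs Jc hm LC CC hf.
have [_ [Gpos _]] := hm.
have bal := balancedE nil cs hm LC.
split; last first.
  move=> /bal l0 j k; rewrite (KtE nil cs Jc hm CC hf) (lee_part0 nil hm hf _ _ l0) addr0.
  by rewrite (ricci11CE nil hm LC (hol_frame_eig hf j) (conj_frame_eig hf k)).
rewrite bal (trKE nil cs Jc hm LC CC hf); split=> [->|].
  by rewrite bform0l mulr0 subr0.
(* Equality of the traces makes the squared norm of [lee] zero; positivity of the metric
   finishes. *)
move/(fmorph_inj (real_complex R))/eqP; rewrite subr_eq addrC -subr_eq subrr eq_sym.
rewrite mulf_eq0 invr_eq0 pnatr_eq0 /= => /eqP E.
by apply/eqP/negPn/negP => /Gpos; rewrite E ltxx.
Qed.
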